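(* Let $\mathcal{H}$ be a complex Hilbert space, let $T\in\mathcal{B}(\mathcal{H})$ be a concave operator and let $m,n\ge1$ be integers. Then $T^n$ is a $\Delta_{T^m}$-contraction and $\mathcal{N}(\Delta_T)=\mathcal{N}(\Delta_{T^n})$. Moreover, if $T$ is $\Delta_T$-regular, then the following statements are equivalent: (i) $T^n$ is $\Delta_{T^m}$-regular for every $m,n\ge1$; (ii) the compression $\widehat{T}=P_{\overline{\mathcal{R}(\Delta_T)}}T|_{\overline{\mathcal{R}(\Delta_T)}}$ is quasinormal; (iii) $\widehat{T}$ commutes with $\widehat{Z}^*\widehat{Z}$, where $\widehat{Z}=P_{\mathcal{N}(\Delta_T)}T|_{\overline{\mathcal{R}(\Delta_T)}}$; (iv) the Cauchy dual $T'=T(T^*T)^{-1}$ is a $D_{T'^2}^2$-contraction which is $D_{T'^2}^2$-regular; (v) the compression $T'_0=P_{\overline{\mathcal{R}(\Delta_T)}}T'|_{\overline{\mathcal{R}(\Delta_T)}}$ is quasinormal; (vi) $T'_0$ commutes with $T_1'^*T_1'$, where $T'_1=P_{\mathcal{N}(\Delta_T)}T'|_{\overline{\mathcal{R}(\Delta_T)}}$.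
   Context: For an operator $A$, $\Delta_A=A^*A-I$. $T$ is concave if $T^{*2}T^2-2T^*T+I\le0$ (then $T$ is left invertible and $T'$ is a contraction). For a positive operator $A$, an operator $R$ is an $A$-contraction if $R^*AR\le A$, and is $A$-regular if $AR=A^{1/2}RA^{1/2}$. For a contraction $C$, $D_C^2=I-C^*C$ and $D_C=(I-C^*C)^{1/2}$. An operator $Q$ is quasinormal if $QQ^*Q=Q^*Q^2$. *)

(* Defs.v *)
(* complex scalars C = R[i] (R : realType), i.e. the field of
   complex numbers; Hilbert spaces and bounded operators are set up by hand. *)
From Stdlib Require Import ClassicalEpsilon.
From mathcomp Require Import all_boot all_order all_algebra.
From mathcomp Require Import complex.
From mathcomp Require Import reals.
Import GRing.Theory Num.Theory.
Set Implicit Arguments. Unset Strict Implicit. Unset Printing Implicit Defensive.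
Local Open Scope ring_scope.
Local Open Scope complex_scope.

Section HilbertDefs.
Variable R : realType.
Local Notation C := R[i].
Variable H : lmodType C.
Variable ip : H -> H -> C.   (* inner product <x, y>, linear in x *)

(* norm ||x|| = sqrt <x,x> *)
Definition hnorm (x : H) : C := sqrtC (ip x x).

(* (H, ip) is a complex Hilbert space: inner product + completeness *)
Definition is_hilbert : Prop :=
  [/\ (forall (a : C) (x y z : H), ip (a *: x + y) z = a * ip x z + ip y z),
      (forall x y : H, ip x y = (ip y x)^*),
      (forall x : H, 0 <= ip x x),
      (forall x : H, ip x x = 0 -> x = 0) &
      (forall u : nat -> H,
         (forall e : C, 0 < e -> exists N, forall m n, (N <= m)%N -> (N <= n)%N ->
             hnorm (u m - u n) < e) ->
         exists l : H, forall e : C, 0 < e -> exists N, forall n, (N <= n)%N ->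
             hnorm (u n - l) < e)].

(* bounded linear operators B(H) *)
Definition bop (S : H -> H) : Prop :=
  (forall (a : C) (x y : H), S (a *: x + y) = a *: S x + S y) /\
  exists M : C, forall x, hnorm (S x) <= M * hnorm x.

Definition idop : H -> H := fun x => x.

(* the Hilbert-space adjoint S^* (unique operator with <S x, y> = <x, S^* y>) *)
Definition adj (S : H -> H) : H -> H :=
  epsilon (inhabits idop) (fun A => bop A /\ forall x y, ip (S x) y = ip x (A y)).

(* n-th power of an operator *)
Definition opow (S : H -> H) (n : nat) : H -> H := iter n (fun A => S \o A) idop.

(* operator order: A <= B iff <A x, x> <= <B x, x> for every x
   (the order of C: w - z real and nonnegative) *)
Definition ople (A B : H -> H) : Prop := forall x, ip (A x) x <= ip (B x) x.
Definition zeroop : H -> H := fun _ => 0.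

(* Delta_A = A^* A - I *)
Definition Delta (A : H -> H) : H -> H := fun x => adj A (A x) - x.
(* D_C^2 = I - C^* C *)
Definition Dsq (A : H -> H) : H -> H := fun x => x - adj A (A x).

(* T is concave: T^*2 T^2 - 2 T^* T + I <= 0 *)
Definition concave (T : H -> H) : Prop :=
  ople (fun x => adj (opow T 2) (opow T 2 x) - 2%:R *: adj T (T x) + x) zeroop.

(* positive square root A^{1/2} of a positive operator A *)
Definition opsqrt (A : H -> H) : H -> H :=
  epsilon (inhabits idop) (fun S => bop S /\ ople zeroop S /\ S \o S = A).

(* R is an A-contraction: R^* A R <= A *)
Definition Acontraction (A Rr : H -> H) : Prop :=
  ople (fun x => adj Rr (A (Rr x))) A.
(* R is A-regular: A R = A^{1/2} R A^{1/2} *)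
Definition Aregular (A Rr : H -> H) : Prop :=
  A \o Rr = opsqrt A \o Rr \o opsqrt A.

(* inverse of an invertible operator *)
Definition opinv (A : H -> H) : H -> H :=
  epsilon (inhabits idop)
    (fun B => bop B /\ A \o B = idop /\ B \o A = idop).

(* Cauchy dual T' = T (T^* T)^{-1} *)
Definition cdual (T : H -> H) : H -> H := T \o opinv (adj T \o T).

(* quasinormal: Q Q^* Q = Q^* Q^2 *)
Definition quasinormal (Q : H -> H) : Prop :=
  Q \o adj Q \o Q = adj Q \o Q \o Q.

(* kernel, range and its closure *)
Definition kerop (A : H -> H) : H -> Prop := fun x => A x = 0.
Definition ranop (A : H -> H) : H -> Prop := fun y => exists x, A x = y.
Definition hclosure (M : H -> Prop) : H -> Prop :=
  fun x => forall e : C, 0 < e -> exists y, M y /\ hnorm (x - y) < e.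

(* orthogonal projection P_M onto a closed subspace M *)
Definition orthproj (M : H -> Prop) : H -> H :=
  epsilon (inhabits idop)
    (fun P => bop P /\ P \o P = P /\ adj P = P /\ forall x, M x <-> P x = x).

(* compression P_N S|_M of S, represented as the operator P_N S P_M on H *)
Definition compress (N M : H -> Prop) (S : H -> H) : H -> H :=
  orthproj N \o S \o orthproj M.

Definition commute_op (A B : H -> H) : Prop := A \o B = B \o A.

End HilbertDefs.

(* Main.v *)
(* Write [D = Delta_T], let [P] be the projection onto the closure of its range, and
   put [S = PTP]. Norms along an orbit of [T] form a concave nonnegative, hence
   nondecreasing, sequence; this gives the first two assertions and the invariance of
   [ker D] under [T]. For a positive [A] with [ker A = ker P] and an operator [W] leaving
   [ker P] invariant, [W] is [A]-regular iff [PWP] commutes with [A], since the square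
   root of [A] commutes with everything that commutes with [A]. Hence [S] commutes with
   [D], therefore with [G = (T^*T)^-1 = (1 + D)^-1], and the compression of the Cauchy
   dual [T' = TG] is [SG]. All conditions then reduce to [S] commuting with [S^*S], by
   [Z^*Z = P + D - S^*S], [Delta_(T^(m+1)) = D + S^* Delta_(T^m) S] and
   [D_(T'^2)^2 = E + (SG)^* E (SG)] with [E = 1 - G]. *)
Require Import Defs.
From Stdlib Require Import ClassicalEpsilon.
From mathcomp Require Import all_boot all_order all_algebra.
From mathcomp Require Import complex.
From mathcomp Require Import reals.
From mathcomp Require Import boolp classical_sets ring lra.
Import Order.TTheory GRing.Theory Num.Theory.
Set Implicit Arguments. Unset Strict Implicit. Unset Printing Implicit Defensive.
Local Open Scope ring_scope.
Local Open Scope complex_scope.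

(** * Inner products and the Riesz lemma *)

Section RealInnerProduct.
Variables (R : realType) (H : lmodType R[i]) (ip : H -> H -> R[i]).
Hypothesis hH : is_hilbert ip.

(** Adjoint, square root, inverse and projection are epsilon choices: each needs an existence proof
    before anything can be said about it, and uniqueness before it can be identified. The Riesz
    lemma is stated for closed subspaces so that it serves three times: on the whole space for
    adjoints, on a subspace for projections, and with the inner product [<Tx, Ty>] for the inverse
    of [T^*T]. Square roots come from a monotone iteration whose terms are polynomials in the
    operator, which also yields the commutation property. Compressions are kept as operators [P W P]
    on all of [H], so cancelling [D] on the range of [P] reads: [D x = 0] forces [P x = 0]. This
    turns an identity [D (S^*S S - S S^*S) = 0] into quasinormality, since both terms of the bracket
    lie in the range of [P]. *)

Definition rip (x y : H) : R := complex.Re (ip x y).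
Definition nrm (x : H) : R := Num.sqrt (rip x x).

Lemma ipDl x y z : ip (x + y) z = ip x z + ip y z.
Proof. by case: hH => L _ _ _ _; have := L 1 x y z; rewrite scale1r mul1r. Qed.

Lemma ip0l z : ip 0 z = 0.
Proof. by apply: (addrI (ip 0 z)); rewrite -ipDl !addr0. Qed.

Lemma ipZl a x z : ip (a *: x) z = a * ip x z.
Proof. by case: hH => L _ _ _ _; have := L a x 0 z; rewrite addr0 ip0l addr0. Qed.

Lemma ipNl x z : ip (- x) z = - ip x z.
Proof. by rewrite -scaleN1r ipZl mulN1r. Qed.

Lemma ipBl x y z : ip (x - y) z = ip x z - ip y z.
Proof. by rewrite ipDl ipNl. Qed.

Lemma ipC x y : ip x y = (ip y x)^*.
Proof. by case: hH. Qed.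

Lemma ipDr x y z : ip z (x + y) = ip z x + ip z y.
Proof. by rewrite ipC ipDl rmorphD /= -!ipC. Qed.

Lemma ip0r z : ip z 0 = 0.
Proof. by rewrite ipC ip0l conjc0. Qed.

Lemma ipZr a x z : ip z (a *: x) = a^* * ip z x.
Proof. by rewrite ipC ipZl rmorphM /= -ipC. Qed.

Lemma ipZr_real (t : R) x z : ip z (t%:C *: x) = t%:C * ip z x.
Proof. rewrite ipZr; congr (_ * _); exact: conjc_real. Qed.

Lemma ipNr x z : ip z (- x) = - ip z x.
Proof. by rewrite ipC ipNl rmorphN /= -ipC. Qed.

Lemma ipBr x y z : ip z (x - y) = ip z x - ip z y.
Proof. by rewrite ipDr ipNr. Qed.

Lemma ip_ge0 x : 0 <= ip x x.
Proof. by case: hH. Qed.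

Lemma ip_eq0 x : ip x x = 0 -> x = 0.
Proof. by case: hH => _ _ _ h _; apply: h. Qed.

Lemma ipxx x : ip x x = (rip x x)%:C.
Proof. by have := ip_ge0 x; rewrite /rip; case: (ip x x) => a b /ger0_Im /= ->. Qed.

Lemma rip_ge0 x : 0 <= rip x x.
Proof. by have := ip_ge0 x; rewrite ipxx ler0c. Qed.

Lemma rip_eq0 x : rip x x = 0 -> x = 0.
Proof. by move=> h; apply: ip_eq0; rewrite ipxx h. Qed.

Lemma ip_inj x y : (forall z, ip z x = ip z y) -> x = y.
Proof.
by move=> h; apply/eqP; rewrite -subr_eq0; apply/eqP/ip_eq0; rewrite ipBr h subrr.
Qed.

Lemma ReD (a b : R[i]) : complex.Re (a + b) = complex.Re a + complex.Re b.
Proof. by case: a b => [a b] []. Qed.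

Lemma ReN (a : R[i]) : complex.Re (- a) = - complex.Re a.
Proof. by case: a. Qed.

Lemma ReZ (t : R) (a : R[i]) : complex.Re (t%:C * a) = t * complex.Re a.
Proof. by case: a => a b /=; rewrite mul0r subr0. Qed.

Lemma ripC x y : rip x y = rip y x.
Proof. by rewrite /rip ipC; case: (ip y x). Qed.

Lemma ripDl x y z : rip (x + y) z = rip x z + rip y z.
Proof. by rewrite /rip ipDl ReD. Qed.

Lemma ripNl x z : rip (- x) z = - rip x z.
Proof. by rewrite /rip ipNl ReN. Qed.

Lemma ripBl x y z : rip (x - y) z = rip x z - rip y z.
Proof. by rewrite ripDl ripNl. Qed.

Lemma ripZl (t : R) x z : rip (t%:C *: x) z = t * rip x z.
Proof. by rewrite /rip ipZl ReZ. Qed.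

Lemma ripDr x y z : rip z (x + y) = rip z x + rip z y.
Proof. by rewrite ripC ripDl !(ripC _ z). Qed.

Lemma ripNr x z : rip z (- x) = - rip z x.
Proof. by rewrite ripC ripNl (ripC z). Qed.

Lemma ripBr x y z : rip z (x - y) = rip z x - rip z y.
Proof. by rewrite ripDr ripNr. Qed.

Lemma ripZr (t : R) x z : rip z (t%:C *: x) = t * rip z x.
Proof. by rewrite ripC ripZl ripC. Qed.

Definition ripE := (ripDl, ripDr, ripBl, ripBr, ripZl, ripZr, ripNl, ripNr).

(** Recovers the imaginary part of [ip] from [rip], so that an identity of real parts valid for all
    vectors lifts to a complex one. *)
Lemma rip_iZl x y : rip ('i *: x) y = - complex.Im (ip x y).
Proof. by rewrite /rip ipZl; case: (ip x y) => a b /=; rewrite mul0r mul1r sub0r. Qed.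

Lemma rip0l z : rip 0 z = 0.
Proof. by rewrite /rip ip0l. Qed.

(** Common source of Cauchy-Schwarz, of its version for positive operators, and of the first-order
    condition at a Riesz minimiser. *)
Lemma quadratic_discr_le (a b c : R) :
  (forall t, 0 <= a + 2 * t * b + t ^+ 2 * c) -> b ^+ 2 <= a * c.
Proof.
move=> h; have a0 : 0 <= a by have := h 0; rewrite mulr0 mul0r expr0n mul0r !addr0.
have c0 : 0 <= c.
  rewrite leNgt; apply/negP => c0.
  (* Adding the hypotheses at [t] and [-t] removes [b]. For [t = 1 + a / (-c) >= 1] one has
     [t^2 (-c) >= t (-c) = a - c > a], a contradiction. *)
  have a1 : 0 <= a / - c by apply: divr_ge0; lra.
  have tE : (1 + a / - c) * - c = - c + a by field; lra.
  have := h (1 + a / - c); have := h (- (1 + a / - c)).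
  set t := 1 + _ in tE *; have t1 : 1 <= t by rewrite /t; lra.
  nra.
have [c1|c1] := eqVneq c 0.
  rewrite c1 mulr0; rewrite c1 in h.
  have [->|b0] := eqVneq b 0; first by rewrite expr0n.
  have := h (- (a + 1) / (2 * b)).
  have -> : a + 2 * (- (a + 1) / (2 * b)) * b + (- (a + 1) / (2 * b)) ^+ 2 * 0 = -1.
    by field.
  lra.
have c2 : 0 < c by rewrite lt_neqAle eq_sym c1.
have := h (- b / c).
have -> : a + 2 * (- b / c) * b + (- b / c) ^+ 2 * c = (a * c - b ^+ 2) / c by field.
by rewrite pmulr_lge0 ?invr_gt0 // subr_ge0.
Qed.

Lemma rip_CS x y : rip x y ^+ 2 <= rip x x * rip y y.
Proof.
apply: quadratic_discr_le => t; have := rip_ge0 (x + t%:C *: y).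
rewrite !ripE (ripC y x); lra.
Qed.

Lemma nrm_ge0 x : 0 <= nrm x.
Proof. exact: sqrtr_ge0. Qed.

Lemma nrm_sqr x : nrm x ^+ 2 = rip x x.
Proof. by rewrite sqr_sqrtr // rip_ge0. Qed.

Lemma nrm_le x (c : R) : 0 <= c -> (nrm x <= c) = (rip x x <= c ^+ 2).
Proof. by move=> c0; rewrite -nrm_sqr ler_sqr ?nnegrE ?nrm_ge0. Qed.

Lemma nrm_lt x (c : R) : 0 <= c -> (nrm x < c) = (rip x x < c ^+ 2).
Proof. by move=> c0; rewrite -nrm_sqr ltr_sqr ?nnegrE ?nrm_ge0. Qed.

Lemma nrm_eq0 x : nrm x = 0 -> x = 0.
Proof. by move=> h; apply: rip_eq0; rewrite -nrm_sqr h expr0n. Qed.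

Lemma rip_le x y : rip x y <= nrm x * nrm y.
Proof.
apply: le_trans (ler_norm _) _; rewrite -ler_sqr ?nnegrE ?mulr_ge0 ?nrm_ge0 //.
by rewrite real_normK ?num_real // exprMn !nrm_sqr rip_CS.
Qed.

Lemma nrmD x y : nrm (x + y) <= nrm x + nrm y.
Proof.
rewrite nrm_le ?addr_ge0 ?nrm_ge0 // !ripE (ripC y x) sqrrD !nrm_sqr.
by have := rip_le x y; lra.
Qed.

Lemma nrmN x : nrm (- x) = nrm x.
Proof. by rewrite /nrm !ripE opprK. Qed.

Lemma nrmB x y : nrm (x - y) = nrm (y - x).
Proof. by rewrite -nrmN opprB. Qed.

Lemma nrm_tri x y z : nrm (x - z) <= nrm (x - y) + nrm (y - z).
Proof. by apply: le_trans (nrmD _ _); rewrite addrA subrK. Qed.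

Lemma nrmZ (t : R) x : 0 <= t -> nrm (t%:C *: x) = t * nrm x.
Proof.
by move=> t0; rewrite /nrm !ripE mulrA -expr2 sqrtrM ?sqr_ge0 // sqrtr_sqr ger0_norm.
Qed.

Lemma nrm0 : nrm 0 = 0.
Proof. by rewrite /nrm rip0l sqrtr0. Qed.

Lemma hnormE x : hnorm ip x = (nrm x)%:C.
Proof.
rewrite /hnorm ipxx -nrm_sqr rmorphXn sqrCK // ler0c; exact: nrm_ge0.
Qed.

Lemma gt0C (e : R[i]) : 0 < e -> exists2 t : R, 0 < t & e = t%:C.
Proof.
case: e => a b; rewrite ltcE /= => /andP[/eqP -> a0]; by exists a.
Qed.

(** * Norm convergence and completeness *)

Definition tends (u : nat -> H) (l : H) : Prop :=
  forall e : R, 0 < e -> exists N, forall n, (N <= n)%N -> nrm (u n - l) < e.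

Lemma hilbert_complete (u : nat -> H) :
  (forall e : R, 0 < e -> exists N, forall m n, (N <= m)%N -> (N <= n)%N ->
     nrm (u m - u n) < e) -> exists l, tends u l.
Proof.
case: hH => _ _ _ _ /(_ u) comp hu.
have [|l hl] := comp.
  move=> _ /gt0C[t t0 ->]; have [N hN] := hu t t0.
  by exists N => m n hm hn; rewrite hnormE ltcR hN.
exists l => e e0; have [|N hN] := hl e%:C; first by rewrite ltcR.
by exists N => n /hN; rewrite hnormE ltcR.
Qed.

Lemma tends_uniq u l l' : tends u l -> tends u l' -> l = l'.
Proof.
move=> h h'; apply/eqP; rewrite -subr_eq0; apply/eqP/nrm_eq0/eqP.
rewrite eq_le nrm_ge0 andbT leNgt; apply/negP => n0.
have e0 : 0 < nrm (l - l') / 2 by lra.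
have [N hN] := h _ e0; have [N' hN'] := h' _ e0.
have := hN (maxn N N') (leq_maxl _ _); have := hN' (maxn N N') (leq_maxr _ _).
have := nrm_tri l (u (maxn N N')) l'; rewrite (nrmB l (u _)); lra.
Qed.

Lemma tends0_le u l (v : nat -> H) (c : R) : 0 <= c ->
  (forall n, nrm (v n) <= c * nrm (u n - l)) -> tends u l -> tends v 0.
Proof.
move=> c0 hv hu e e0; have c1 : 0 < c + 1 by lra.
have [N hN] := hu (e / (c + 1)) (divr_gt0 e0 c1).
exists N => n /hN; rewrite subr0 ltr_pdivlMr // => h.
apply: le_lt_trans (hv n) _; have := nrm_ge0 (u n - l); nra.
Qed.

Lemma tendsD u l v k : tends u l -> tends v k -> tends (fun n => u n + v n) (l + k).
Proof.
move=> h h' e e0; have e2 : 0 < e / 2 by lra.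
have [N hN] := h _ e2; have [N' hN'] := h' _ e2.
exists (maxn N N') => n; rewrite geq_max => /andP[/hN a /hN' b].
rewrite opprD addrACA; apply: le_lt_trans (nrmD _ _) _; lra.
Qed.

Lemma tends_cst l : tends (fun=> l) l.
Proof. by move=> e e0; exists 0%N => n _; rewrite subrr nrm0. Qed.

Lemma tends_sub0 u l : tends (fun n => u n - l) 0 -> tends u l.
Proof. by move=> h e /h[N hN]; exists N => n /hN; rewrite subr0. Qed.


Lemma inv_succ_lt (e : R) : 0 < e -> exists N, forall n, (N <= n)%N -> n.+1%:R^-1 < e.
Proof.
move=> e0; exists (Num.bound e^-1) => n hn.
rewrite invf_plt ?posrE ?ltr0n //; apply: lt_le_trans (archi_boundP _) _.
  by rewrite invr_ge0 ltW.
by rewrite ler_nat leqW.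
Qed.

(* The representing vector is the minimiser over [M] of the functional
   [|x|^2 - 2 Re (f x)]; the parallelogram law makes minimising sequences Cauchy. *)
Lemma riesz_subspace (M : H -> Prop) (f : H -> R[i]) (c : R) :
  M 0 -> (forall a x y, M x -> M y -> M (a *: x + y)) ->
  (forall u l, (forall n, M (u n)) -> tends u l -> M l) ->
  (forall a x y, f (a *: x + y) = a * f x + f y) ->
  (forall x, complex.Re (f x) <= c * nrm x) ->
  exists2 u, M u & forall x, M x -> f x = ip x u.
Proof.
move=> M0 Mlin Mcl flin fbd.
pose g x := complex.Re (f x); pose J x := rip x x - 2 * g x.
have fD x y : f (x + y) = f x + f y by have := flin 1 x y; rewrite scale1r mul1r.
have f0 : f 0 = 0 by apply: (addrI (f 0)); rewrite -fD !addr0.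
have fZ a x : f (a *: x) = a * f x by have := flin a x 0; rewrite f0 !addr0.
have gD x y : g (x + y) = g x + g y by rewrite /g fD ReD.
have gZ (t : R) x : g (t%:C *: x) = t * g x by rewrite /g fZ ReZ.
have MD x y : M x -> M y -> M (x + y) by rewrite -{2}[x]scale1r; apply: Mlin.
have MZ a x : M x -> M (a *: x) by move=> hx; rewrite -[_ *: x]addr0; apply: Mlin.
pose E : set R := [set r | exists2 x, M x & r = J x]%classic.
have Elb : has_lbound E.
  exists (- c ^+ 2) => _ [x _ ->]; rewrite /J -nrm_sqr.
  have := fbd x; rewrite -/(g x); have := sqr_ge0 (nrm x - c); rewrite sqrrB; lra.
have Einf : has_inf E by split=> //; exists (J 0), 0.
pose d := inf E.
have dle x : M x -> d <= J x by move=> hx; apply: ge_inf => //; exists x.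
have hu n : exists x, M x /\ J x < d + n.+1%:R^-1.
  have [|_ [x hx ->] hlt] := @inf_adherent _ E n.+1%:R^-1 _ Einf.
    by rewrite invr_gt0 ltr0n.
  by exists x.
have [u uP] := choice hu.
(* The parallelogram law combined with [J >= d] at the midpoint of [x] and [y]. *)
have par x y : M x -> M y -> rip (x - y) (x - y) <= 2 * (J x + J y - 2 * d).
  move=> hx hy; have := dle ((2^-1)%:C *: (x + y)) (MZ _ _ (MD _ _ hx hy)).
  rewrite /J gZ gD !ripE (ripC y x); lra.
have [|l ul] := @hilbert_complete u.
  move=> e e0; have e2 : 0 < e ^+ 2 / 4 by have := exprn_gt0 2 e0; lra.
  have [N hN] := inv_succ_lt e2.
  exists N => m n /hN hm /hN hn; rewrite nrm_lt ?(ltW e0) //.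
  have [Mm Jm] := uP m; have [Mn Jn] := uP n.
  apply: le_lt_trans (par _ _ Mm Mn) _.
  move: (J _) (J _) (m.+1%:R^-1) (n.+1%:R^-1) Jm Jn hm hn => a b p q Jm Jn hm hn; lra.
have Ml : M l by apply: Mcl ul => n; case: (uP n).
have key x : M x -> g x = rip x l.
  (* Minimality tested at [u n - t x] gives [2 t (g x - <x, u n>) + t^2 |x|^2 >= - 1/(n+1)]. In the
     limit this is a nonnegative quadratic in [t] with zero constant term, so its linear coefficient
     vanishes. *)
  move=> hx; apply/eqP; rewrite -subr_eq0 -sqrf_eq0 eq_le sqr_ge0 andbT.
  rewrite -(mul0r (rip x x)); apply: quadratic_discr_le => t.
  rewrite add0r; apply/ler_addgt0Pl => e e0.
  have e2 : 0 < e / 2 by lra.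
  have [N hN] := inv_succ_lt e2.
  pose s := 2 * `|t| * nrm x + 1.
  have s0 : 0 < s by rewrite /s; have := mulr_ge0 (normr_ge0 t) (nrm_ge0 x); lra.
  have [N' hN'] := ul (e / 2 / s) (divr_gt0 e2 s0).
  pose n := maxn N N'.
  have := hN n (leq_maxl _ _); have := hN' n (leq_maxr _ _).
  rewrite ltr_pdivlMr // => h1 h2.
  have [Mn Jn] := uP n.
  have := dle (u n + (- t)%:C *: x) (MD _ _ Mn (MZ _ _ hx)).
  move: Jn; rewrite /J gD gZ !ripE (ripC (u n) x).
  have h3 : - 2 * t * (rip x (u n) - rip x l) <= e / 2.
    rewrite -ripBr -mulrA -ripZl.
    have -> : -2 * rip (t%:C *: x) (u n - l) = rip ((- 2 * t)%:C *: x) (u n - l).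
      by rewrite !ripZl; ring.
    apply: le_trans (rip_le _ _) _.
    have -> : nrm ((-2 * t)%:C *: x) = 2 * `|t| * nrm x.
      rewrite /nrm ripZl ripZr mulrA -expr2 sqrtrM ?sqr_ge0 // sqrtr_sqr normrM.
      by rewrite normrN (ger0_norm (ler0n _ 2)).
    move: h1; rewrite /s; have := nrm_ge0 (u n - l); lra.
  move: (n.+1%:R^-1) h2 => p h2 h4 h5; lra.
exists l => // x hx.
have k1 := key _ hx; have := key _ (MZ 'i _ hx); rewrite rip_iZl /g fZ.
move: k1; rewrite /g /rip; case: (f x) => a b; case: (ip x l) => p q /= ->.
by rewrite mul0r mul1r sub0r => /oppr_inj ->.
Qed.

End RealInnerProduct.

(** * Bounded operators and adjoints *)

Section BoundedOperators.
Variables (R : realType) (H : lmodType R[i]) (ip : H -> H -> R[i]).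
Hypothesis hH : is_hilbert ip.
Implicit Types S A B : H -> H.

(** The constant in [bop] is any complex number, but [M * hnorm x] dominates a nonnegative real,
    hence is itself real and nonnegative and equals [|M| * hnorm x]. *)
Lemma bopP S : bop ip S <->
  (forall a x y, S (a *: x + y) = a *: S x + S y) /\
  exists2 r : R, 0 <= r & forall x, nrm ip (S x) <= r * nrm ip x.
Proof.
split=> -[Sl Sb]; split=> //.
  case: Sb => M hM; exists (complex.Re `|M|).
    by have := normr_ge0 M; rewrite lecE => /andP[].
  move=> x; have := hM x; rewrite !(hnormE hH) => h.
  have h0 : 0 <= M * (nrm ip x)%:C.
    by apply: le_trans h; rewrite ler0c; exact: nrm_ge0.
  move: h; rewrite -[M * _]ger0_norm // normrM (ger0_norm (x := (nrm ip x)%:C)).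
    rewrite -[`|M|]RRe_real ?normr_real // -rmorphM lecR.
    by rewrite RRe_real ?normr_real.
  by rewrite ler0c; exact: nrm_ge0.
case: Sb => r _ hr; exists r%:C => x.
by rewrite !(hnormE hH) -rmorphM lecR.
Qed.

Lemma bop_nrm S : bop ip S ->
  exists2 r : R, 0 <= r & forall x, nrm ip (S x) <= r * nrm ip x.
Proof. by case/bopP. Qed.

Lemma bop_lin S (hS : bop ip S) a x y : S (a *: x + y) = a *: S x + S y.
Proof. by case: hS. Qed.

Lemma bopD S (hS : bop ip S) x y : S (x + y) = S x + S y.
Proof. by have := bop_lin hS 1 x y; rewrite !scale1r. Qed.

Lemma bop0 S (hS : bop ip S) : S 0 = 0.
Proof. by apply: (addrI (S 0)); rewrite -(bopD hS) !addr0. Qed.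

Lemma bopZ S (hS : bop ip S) a x : S (a *: x) = a *: S x.
Proof. by have := bop_lin hS a x 0; rewrite (bop0 hS) !addr0. Qed.

Lemma bopN S (hS : bop ip S) x : S (- x) = - S x.
Proof. by rewrite -scaleN1r (bopZ hS) scaleN1r. Qed.

Lemma bopB S (hS : bop ip S) x y : S (x - y) = S x - S y.
Proof. by rewrite (bopD hS) (bopN hS). Qed.

Lemma bop_tends S u l : bop ip S -> tends ip u l -> tends ip (fun n => S (u n)) (S l).
Proof.
move=> hS hu; have [r r0 hr] := bop_nrm hS.
apply: tends_sub0; apply: (tends0_le r0 _ hu) => n.
by rewrite -(bopB hS).
Qed.

Lemma bop_id : bop ip (@idop R H).
Proof. by apply/bopP; split=> //; exists 1 => // x; rewrite mul1r. Qed.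

Lemma bop_zero : bop ip (@zeroop R H).
Proof.
apply/bopP; split; first by move=> a x y; rewrite /zeroop scaler0 addr0.
by exists 0 => // x; rewrite mul0r /zeroop (nrm0 hH).
Qed.

Lemma bop_comp S A : bop ip S -> bop ip A -> bop ip (S \o A).
Proof.
move=> hS hA; have [r r0 hr] := bop_nrm hS; have [s s0 hs] := bop_nrm hA.
apply/bopP; split=> [a x y|]; first by rewrite /= (bop_lin hA) (bop_lin hS).
exists (r * s); first exact: mulr_ge0.
by move=> x; apply: le_trans (hr _) _; rewrite -mulrA ler_wpM2l.
Qed.

Lemma bop_add S A : bop ip S -> bop ip A -> bop ip (fun x => S x + A x).
Proof.
move=> hS hA; have [r r0 hr] := bop_nrm hS; have [s s0 hs] := bop_nrm hA.
apply/bopP; split=> [a x y|]; first by rewrite (bop_lin hA) (bop_lin hS) scalerDr addrACA.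
exists (r + s); first exact: addr_ge0.
by move=> x; apply: le_trans (nrmD hH _ _) _; rewrite mulrDl lerD.
Qed.

Lemma bop_scale (c : R[i]) S : bop ip S -> bop ip (fun x => c *: S x).
Proof.
move=> hS; have [r r0 hr] := bop_nrm hS.
split=> [a x y|]; first by rewrite (bop_lin hS) scalerDr !scalerA mulrC.
exists (`|c| * r%:C) => x.
have -> : hnorm ip (c *: S x) = `|c| * hnorm ip (S x).
  rewrite /hnorm (ipZl hH) (ipZr hH) mulrA -sqr_normc.
  by rewrite rootCMl ?exprn_ge0 // sqrCK.
by rewrite -mulrA ler_wpM2l // !(hnormE hH) -rmorphM lecR.
Qed.

Lemma bop_sub S A : bop ip S -> bop ip A -> bop ip (fun x => S x - A x).
Proof.
move=> hS hA; have := bop_add hS (bop_scale (-1) hA).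
by congr bop; apply/funext => x; rewrite scaleN1r.
Qed.

Lemma bop_opow S n : bop ip S -> bop ip (opow S n).
Proof.
by move=> hS; elim: n => [|n IH]; [exact: bop_id | exact: bop_comp hS IH].
Qed.

(** [A y] is the Riesz vector of [x |-> ip (S x) y]. From [|A y|^2 = Re <S (A y), y> <= r |A y| |y|]
    the bound of [S] also bounds [A]. *)
Lemma adj_exists S : bop ip S ->
  exists A, bop ip A /\ forall x y, ip (S x) y = ip x (A y).
Proof.
move=> hS; have [r r0 hr] := bop_nrm hS.
have hA y : exists u, forall x, ip (S x) y = ip x u.
  have [|||||u _ hu] :=
    @riesz_subspace _ _ _ hH (fun=> True) (fun x => ip (S x) y) (r * nrm ip y).
  - by [].
  - by [].
  - by [].
  - by move=> a x z; rewrite (bop_lin hS) (ipDl hH) (ipZl hH).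
  - move=> x; apply: le_trans (rip_le hH _ _) _.
    by rewrite mulrAC ler_wpM2r // nrm_ge0.
  by exists u => x; apply: hu.
have [A AP] := choice hA; exists A; split=> //.
apply/bopP; split=> [a x y|].
  apply: (ip_inj hH) => z.
  by rewrite (ipDr hH) (ipZr hH) -!AP (ipDr hH) (ipZr hH).
exists r => // x.
have [->|nz] := eqVneq (nrm ip (A x)) 0; first by rewrite mulr_ge0 ?nrm_ge0.
have np : 0 < nrm ip (A x) by rewrite lt_neqAle eq_sym nz nrm_ge0.
rewrite -(ler_pM2l np) -expr2 (nrm_sqr hH) /rip -AP.
apply: le_trans (rip_le hH _ _) _.
by rewrite mulrCA mulrA ler_wpM2r ?nrm_ge0.
Qed.

Lemma adj_spec S : bop ip S ->
  bop ip (adj ip S) /\ forall x y, ip (S x) y = ip x (adj ip S y).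
Proof. move=> hS; exact: (epsilon_spec (inhabits (@idop R H)) _ (adj_exists hS)). Qed.

Lemma bop_adj S : bop ip S -> bop ip (adj ip S).
Proof. by case/adj_spec. Qed.

Lemma adjE S (hS : bop ip S) x y : ip (S x) y = ip x (adj ip S y).
Proof. by case: (adj_spec hS). Qed.

Lemma adjE' S (hS : bop ip S) x y : ip (adj ip S x) y = ip x (S y).
Proof. by rewrite (ipC hH) -(adjE hS) -(ipC hH). Qed.

Lemma adj_uniq S A : bop ip S -> (forall x y, ip (S x) y = ip x (A y)) -> adj ip S = A.
Proof.
move=> hS hA; apply/funext => y; apply: (ip_inj hH) => z.
by rewrite -(adjE hS) hA.
Qed.

Lemma adj_comp S A : bop ip S -> bop ip A -> adj ip (S \o A) = adj ip A \o adj ip S.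
Proof.
move=> hS hA; apply: adj_uniq => [|x y]; first exact: bop_comp.
by rewrite /= (adjE hS) (adjE hA).
Qed.

(** * Symmetric and positive operators *)

Definition symmetric_op S := forall x y, ip (S x) y = ip x (S y).

(* Polarisation: [<Sz, z>] is real at [z = x + y] and at [z = x + iy]. *)
Lemma positive_symmetric S : bop ip S -> ople ip (@zeroop R H) S -> symmetric_op S.
Proof.
move=> hS hp x y.
have im0 z : complex.Im (ip (S z) z) = 0 by have := hp z; rewrite (ip0l hH) => /ger0_Im.
have := im0 (x + y); rewrite (bopD hS) !(ipDl hH) !(ipDr hH).
have := im0 (x + 'i *: y).
rewrite (bopD hS) (bopZ hS) !(ipDl hH) !(ipDr hH) !(ipZl hH) !(ipZr hH).
rewrite [ip x _](ipC hH).
have := im0 x; have := im0 y.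
case: (ip (S x) x) (ip (S y) y) (ip (S x) y) (ip (S y) x)
  => [a1 a2] [b1 b2] [c1 c2] [d1 d2] /=.
move=> e1 e2 e3 e4; congr (_ +i* _); lra.
Qed.

(** A positive [A] makes [<Ax, y>] a semi-inner product. *)
Lemma positive_CS A x y : bop ip A -> ople ip (@zeroop R H) A ->
  rip ip (A x) y ^+ 2 <= rip ip (A x) x * rip ip (A y) y.
Proof.
move=> hA hp; have sA := positive_symmetric hA hp.
apply: quadratic_discr_le => t.
have := hp (x + t%:C *: y); rewrite (ip0l hH) lecE => /andP[_]; rewrite -/(rip ip _ _) /=.
rewrite (bopD hA) (bopZ hA) !(ripE hH).
have -> : rip ip (A y) x = rip ip (A x) y by rewrite /rip sA -/(rip ip _ _) (ripC hH).
lra.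
Qed.

Lemma positive_rip A x : ople ip (@zeroop R H) A -> 0 <= rip ip (A x) x.
Proof. by move=> /(_ x); rewrite (ip0l hH) lecE => /andP[]. Qed.

(** Cauchy-Schwarz for the form of [A], taken at [y = A x]. This converts equalities of norms into
    membership in kernels of defect operators. *)
Lemma positive_ker A x : bop ip A -> ople ip (@zeroop R H) A ->
  rip ip (A x) x = 0 -> A x = 0.
Proof.
move=> hA hp h; have := positive_CS x (A x) hA hp; rewrite h mul0r.
move=> /(conj (sqr_ge0 (rip ip (A x) (A x)))) /andP; rewrite -eq_le eq_sym sqrf_eq0.
by move/eqP/(rip_eq0 hH).
Qed.

Lemma symmetric_positive A : symmetric_op A -> (forall x, 0 <= rip ip (A x) x) ->
  ople ip (@zeroop R H) A.
Proof.
move=> sA hp x; rewrite (ip0l hH) lecE hp andbT /=.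
have := ipC hH (A x) x; rewrite sA.
by case: (ip x (A x)) => a b [] /= h; apply/eqP; lra.
Qed.

(** From [0 <= A <= 1] follows [A^2 <= A]: with [p = |Ax|^2] and [q = <Ax, x>], Cauchy-Schwarz at
    [y = A x] gives [p^2 <= q <A(Ax), Ax> <= q p]. It upgrades convergence of quadratic forms to
    strong convergence. *)
Lemma positive_le1_nrm A x : bop ip A -> ople ip (@zeroop R H) A ->
  (forall x, rip ip (A x) x <= rip ip x x) ->
  rip ip (A x) (A x) <= rip ip (A x) x.
Proof.
move=> hA hp h1.
have := positive_CS x (A x) hA hp; have := h1 (A x).
have := positive_rip x hp; have := rip_ge0 hH (A x).
set p := rip _ (A x) (A x); set q := rip _ (A x) x; set r := rip _ _ _ => p0 q0 rp pq.
rewrite leNgt; apply/negP => lt; nra.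
Qed.

End BoundedOperators.

(** * Positive square roots *)

Section SquareRoot.
Variables (R : realType) (H : lmodType R[i]) (ip : H -> H -> R[i]).
Hypothesis hH : is_hilbert ip.
Implicit Types S A B F G K : H -> H.

Lemma opowE S n x : opow S n x = iter n S x.
Proof. by elim: n x => //= n IH x; rewrite /comp -/(opow S n) IH. Qed.

Lemma opowD S m n x : opow S (m + n) x = opow S m (opow S n x).
Proof. by rewrite !opowE iterD. Qed.

Lemma opow_comm S K n x : (forall x, S (K x) = K (S x)) -> S (opow K n x) = opow K n (S x).
Proof. by move=> h; rewrite !opowE; elim: n => //= n IH; rewrite h IH. Qed.

(** Used to see that a strong limit of symmetric operators is symmetric. The estimate is one-sided
    and on real parts; exchanging the two sides gives equality, and multiplying by ['i] gives the
    imaginary parts. *)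
Lemma tends_ip_eq u l v k x y : tends ip u l -> tends ip v k ->
  (forall n, ip (u n) y = ip x (v n)) -> ip l y = ip x k.
Proof.
have key u' l' v' k' x' y' : tends ip u' l' -> tends ip v' k' ->
    (forall n, rip ip (u' n) y' = rip ip x' (v' n)) -> rip ip l' y' <= rip ip x' k'.
  move=> hu hv huv; apply/ler_addgt0Pr => e e0.
  have s0 : 0 < nrm ip y' + nrm ip x' + 1.
    by have := nrm_ge0 ip x'; have := nrm_ge0 ip y'; lra.
  have e1 := divr_gt0 e0 s0.
  have [N hN] := hu _ e1; have [N' hN'] := hv _ e1.
  have := hN _ (leq_maxl N N'); have := hN' _ (leq_maxr N N'); set n := maxn N N'.
  have := huv n; rewrite !ltr_pdivlMr // => huvn.
  have := rip_le hH (l' - u' n) y'; have := rip_le hH x' (v' n - k').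
  rewrite (nrmB hH l') (ripBl hH) (ripBr hH) huvn.
  have := nrm_ge0 ip x'; have := nrm_ge0 ip y'.
  have := nrm_ge0 ip (u' n - l'); have := nrm_ge0 ip (v' n - k'); nra.
have keye u' l' v' k' x' y' : tends ip u' l' -> tends ip v' k' ->
    (forall n, rip ip (u' n) y' = rip ip x' (v' n)) -> rip ip l' y' = rip ip x' k'.
  move=> hu hv huv; apply: le_anti; rewrite (key _ _ _ _ _ _ hu hv) //=.
  rewrite (ripC hH x') (ripC hH l'); apply: key hv hu _ => n.
  by rewrite (ripC hH _ x') -huv (ripC hH).
move=> hu hv huv.
have hi := bop_scale hH 'i (bop_id hH).
have /= hiu := bop_tends hH hi hu.
have e1 : rip ip l y = rip ip x k by apply: keye hu hv _ => n; rewrite /rip huv.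
have e2 : rip ip ('i *: l) y = rip ip ('i *: x) k.
  by apply: keye hiu hv _ => n; rewrite !(rip_iZl hH) huv.
move: e1 e2; rewrite !(rip_iZl hH) /rip.
by case: (ip l y) (ip x k) => [a b] [p q] /= -> /oppr_inj ->.
Qed.

Lemma bounded_increasing_cauchy (a : nat -> R) (M : R) :
  (forall m n, (m <= n)%N -> a m <= a n) -> (forall n, a n <= M) ->
  forall e, 0 < e -> exists N, forall n, (N <= n)%N -> a n - a N < e.
Proof.
move=> inc bd e e0; pose E : set R := [set r | exists n, r = a n]%classic.
have Esup : has_sup E by split; [exists (a 0%N), 0%N | exists M => _ [n ->]].
have [_ [N ->] hN] := sup_adherent e0 Esup.
exists N => n hn; have : a n <= sup E by apply: ub_le_sup; [case: Esup | exists n].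
lra.
Qed.

(** Polynomials in [K] with nonnegative coefficients. They are closed under sums and composition,
    are positive when [K] is, and commute with whatever commutes with [K]; hence positivity of the
    increments below needs no theorem on products of commuting positive operators. *)
Inductive nnpoly K : (H -> H) -> Prop :=
| nnpoly0 : nnpoly K (@zeroop R H)
| nnpolyS (c : R) i F : 0 <= c -> nnpoly K F ->
    nnpoly K (fun x => c%:C *: opow K i x + F x).

Lemma nnpoly_ext K F G : nnpoly K F -> F =1 G -> nnpoly K G.
Proof. by move=> h /funext <-. Qed.

Lemma nnpoly_add K F G : nnpoly K F -> nnpoly K G -> nnpoly K (fun x => F x + G x).
Proof.
move=> hF hG; elim: hF => [|c i F' c0 _ IH].
  by apply: nnpoly_ext hG _ => x; rewrite /zeroop add0r.
by apply: nnpoly_ext (nnpolyS i c0 IH) _ => x; rewrite addrA.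
Qed.

Lemma nnpoly_scale K F (c : R) : 0 <= c -> nnpoly K F -> nnpoly K (fun x => c%:C *: F x).
Proof.
move=> c0; elim=> [|d i F' d0 _ IH].
  by apply: nnpoly_ext (nnpoly0 K) _ => x; rewrite /zeroop scaler0.
apply: nnpoly_ext (nnpolyS i (mulr_ge0 c0 d0) IH) _ => x.
by rewrite scalerDr scalerA rmorphM.
Qed.

Lemma nnpoly_pow K F i : bop ip K -> nnpoly K F -> nnpoly K (opow K i \o F).
Proof.
move=> /(bop_opow hH i) hK; elim=> [|d j F' d0 _ IH].
  by apply: nnpoly_ext (nnpoly0 K) _ => x; rewrite /= /zeroop (bop0 hK).
apply: nnpoly_ext (nnpolyS (i + j) d0 IH) _ => x.
by rewrite /= (bop_lin hK) opowD.
Qed.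

Lemma nnpoly_comp K F G : bop ip K -> nnpoly K F -> nnpoly K G -> nnpoly K (F \o G).
Proof.
move=> hK hF hG; elim: hF => [|c i F' c0 _ IH].
  exact: nnpoly_ext (nnpoly0 K) _.
exact: nnpoly_ext (nnpoly_add (nnpoly_scale c0 (nnpoly_pow i hK hG)) IH) _.
Qed.

Lemma nnpoly_var K : nnpoly K K.
Proof.
apply: nnpoly_ext (nnpolyS 1 ler01 (nnpoly0 K)) _ => x.
by rewrite /zeroop addr0 scale1r opowE.
Qed.

Lemma nnpoly_bop K F : bop ip K -> nnpoly K F -> bop ip F.
Proof.
move=> hK; elim=> [|c i F' _ _ IH]; first exact: bop_zero.
exact (bop_add hH (bop_scale hH _ (bop_opow hH i hK)) IH).
Qed.

Lemma nnpoly_comm K F S x : bop ip S -> (forall x, S (K x) = K (S x)) -> nnpoly K F ->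
  S (F x) = F (S x).
Proof.
move=> hS hSK; elim=> [|c i F' _ _ IH]; first by rewrite /zeroop (bop0 hS).
by rewrite (bop_lin hS) IH opow_comm.
Qed.

Lemma symmetric_opow K n : symmetric_op ip K -> symmetric_op ip (opow K n).
Proof.
move=> sK x y; rewrite !opowE; elim: n x y => //= n IH x y.
by rewrite sK IH -iterSr.
Qed.

(** Write [n = 2k + e] with [e] equal to 0 or 1; then [<K^n x, x> = <K^e K^k x, K^k x>]. *)
Lemma positive_opow K n : bop ip K -> ople ip (@zeroop R H) K ->
  ople ip (@zeroop R H) (opow K n).
Proof.
move=> hK pK; have sK := positive_symmetric hH hK pK.
apply: (symmetric_positive hH (symmetric_opow n sK)) => x.
rewrite -(odd_double_half n) addnC -addnn -addnA opowD /rip symmetric_opow //.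
rewrite addnC opowD; case: (odd n); last exact: (rip_ge0 hH).
by rewrite [opow K true _]opowE /=; exact: (positive_rip hH).
Qed.

Lemma nnpoly_positive K F : bop ip K -> ople ip (@zeroop R H) K -> nnpoly K F ->
  ople ip (@zeroop R H) F.
Proof.
move=> hK pK; elim=> [|c i F' c0 _ IH] x; first exact: lexx.
have := IH x; have := positive_opow i hK pK x.
rewrite (ip0l hH) (ipDl hH) (ipZl hH) => h1 h2.
by rewrite addr_ge0 // mulr_ge0 // ler0c.
Qed.

(* Iterating [Y |-> (K + Y^2)/2] approximates [1 - (1 - K)^(1/2)]. *)
Fixpoint sqrt_iter K (n : nat) : H -> H :=
  if n is m.+1 then fun x => (2^-1)%:C *: (K x + sqrt_iter K m (sqrt_iter K m x))
  else @zeroop R H.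

Lemma sqrt_iterS K n x :
  sqrt_iter K n.+1 x = (2^-1)%:C *: (K x + sqrt_iter K n (sqrt_iter K n x)).
Proof. by []. Qed.

Lemma half_ge0 : 0 <= 2^-1 :> R. Proof. by rewrite invr_ge0. Qed.

Lemma nnpoly_sqrt_iter K n : bop ip K -> nnpoly K (sqrt_iter K n).
Proof.
move=> hK; elim: n => [|n IH]; first exact: nnpoly0.
exact: nnpoly_scale half_ge0 (nnpoly_add (nnpoly_var K) (nnpoly_comp hK IH IH)).
Qed.

(** With [Z = Y_(k+1) - Y_k], the difference of squares is [Y_(k+1) Z + Z Y_k], with no commutation
    involved, so each increment is again a nonnegative polynomial in [K]. *)
Lemma nnpoly_sqrt_iterB K m n : bop ip K -> (m <= n)%N ->
  nnpoly K (fun x => sqrt_iter K n x - sqrt_iter K m x).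
Proof.
move=> hK; have hY k := nnpoly_sqrt_iter k hK; have bY k := nnpoly_bop hK (hY k).
have step k : nnpoly K (fun x => sqrt_iter K k.+1 x - sqrt_iter K k x).
  elim: k => [|k IH].
    by apply: nnpoly_ext (hY 1%N) _ => x /=; rewrite /zeroop subr0.
  pose Z x := sqrt_iter K k.+1 x - sqrt_iter K k x.
  have := nnpoly_scale half_ge0
    (nnpoly_add (nnpoly_comp hK (hY k.+1) IH) (nnpoly_comp hK IH (hY k))).
  move/nnpoly_ext; apply=> x; rewrite -/Z /comp.
  rewrite [Z (sqrt_iter _ _ _)]/Z [Z x]/Z (bopB (bY k.+1)) addrA subrK.
  rewrite (sqrt_iterS K k.+1) [in X in _ = _ - X](sqrt_iterS K k) -scalerBr.
  by rewrite opprD [K x + _ + _]addrACA subrr add0r.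
elim: n => [|n IH].
  by rewrite leqn0 => /eqP ->; apply: nnpoly_ext (nnpoly0 K) _ => x; rewrite subrr.
rewrite leq_eqVlt => /predU1P[->|hmn].
  by apply: nnpoly_ext (nnpoly0 K) _ => x; rewrite subrr.
by apply: nnpoly_ext (nnpoly_add (step n) (IH hmn)) _ => x; rewrite addrA subrK.
Qed.

Lemma sqrt_iter_nrm K n x : (forall x, nrm ip (K x) <= nrm ip x) ->
  nrm ip (sqrt_iter K n x) <= nrm ip x.
Proof.
move=> hK; elim: n x => [|n IH] x; first by rewrite /= /zeroop (nrm0 hH) nrm_ge0.
rewrite sqrt_iterS (nrmZ hH) ?half_ge0 //.
have := nrmD hH (K x) (sqrt_iter K n (sqrt_iter K n x)).
have := hK x; have := IH x; have := IH (sqrt_iter K n x); lra.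
Qed.

(** The limit satisfies [Y = (K + Y^2)/2], that is [(1 - Y)^2 = 1 - K]. The forms [<y_n x, x>]
    increase and are bounded by [|x|^2]; since [0 <= y_n - y_m <= 1], they control
    [|y_n x - y_m x|^2], whence pointwise convergence. *)
Lemma sqrt_iter_limit K : bop ip K -> ople ip (@zeroop R H) K ->
  (forall x, rip ip (K x) x <= rip ip x x) ->
  exists Y, [/\ bop ip Y, symmetric_op ip Y, forall x, nrm ip (Y x) <= nrm ip x,
    forall x, Y (Y x) = 2%:C *: Y x - K x &
    forall S, bop ip S -> (forall x, S (K x) = K (S x)) -> forall x, S (Y x) = Y (S x)].
Proof.
move=> hK pK K1.
have Kn x : nrm ip (K x) <= nrm ip x.
  rewrite nrm_le ?nrm_ge0 // (nrm_sqr hH).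
  exact: le_trans (positive_le1_nrm hH x hK pK K1) (K1 x).
pose y := sqrt_iter K.
have yn n x : nrm ip (y n x) <= nrm ip x by exact: sqrt_iter_nrm.
have py n : nnpoly K (y n) := nnpoly_sqrt_iter n hK.
have by_ n : bop ip (y n) := nnpoly_bop hK (py n).
have y1 n x : rip ip (y n x) x <= rip ip x x.
  apply: le_trans (rip_le hH _ _) _; rewrite -(nrm_sqr hH) expr2.
  by rewrite ler_wpM2r ?nrm_ge0.
have dist m n x : (m <= n)%N ->
    nrm ip (y n x - y m x) ^+ 2 <= rip ip (y n x) x - rip ip (y m x) x.
  move=> hmn; have pd := nnpoly_sqrt_iterB hK hmn.
  rewrite (nrm_sqr hH) -(ripBl hH).
  apply: (positive_le1_nrm (A := fun x => y n x - y m x) hH x).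
  - exact: nnpoly_bop pd.
  - exact: nnpoly_positive pd.
  move=> z; rewrite (ripBl hH); have := y1 n z.
  have := positive_rip hH z (nnpoly_positive hK pK (py m)); rewrite -/(y m); lra.
have lim x : exists l, tends ip (fun n => y n x) l.
  apply: (hilbert_complete hH) => e e0.
  have e2 : 0 < (e / 2) ^+ 2 by apply: exprn_gt0; lra.
  have inc m n : (m <= n)%N -> rip ip (y m x) x <= rip ip (y n x) x.
    by move=> /(dist _ _ x) /(le_trans (sqr_ge0 _)); rewrite subr_ge0.
  have [N hN] := bounded_increasing_cauchy inc (fun n => y1 n x) e2.
  have near n : (N <= n)%N -> nrm ip (y n x - y N x) < e / 2.
    move=> hn; have e4 : 0 <= e / 2 by lra.
    rewrite nrm_lt // -(nrm_sqr hH); apply: le_lt_trans (dist _ _ _ hn) _; exact: hN.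
  exists N => m n /near hm /near hn.
  have := nrm_tri hH (y m x) (y N x) (y n x); rewrite (nrmB hH (y N x)); lra.
have [Y YP] := choice lim.
have Yn x : nrm ip (Y x) <= nrm ip x.
  apply/ler_addgt0Pr => e e0; have [N hN] := YP x e e0.
  have := hN N (leqnn N); have := nrm_tri hH (Y x) (y N x) 0.
  rewrite !subr0 (nrmB hH (Y x)); have := yn N x; lra.
have bY : bop ip Y.
  apply/(bopP hH); split=> [a u v|]; last by exists 1 => // x; rewrite mul1r.
  apply: (tends_uniq hH (YP _)).
  have := tendsD hH (bop_tends hH (bop_scale hH a (bop_id hH)) (YP u)) (YP v).
  move=> h e /h[N hN]; exists N => n /hN; rewrite /idop.
  by rewrite (bop_lin (by_ n)).
exists Y; split=> //.
- move=> u v; apply: (tends_ip_eq (YP u) (YP v)) => n.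
  exact: (positive_symmetric hH (by_ n) (nnpoly_positive hK pK (py n))).
- move=> x.
  (* Split [y n (y n x) = y n (y n x - Y x) + y n (Y x)]; the first term vanishes in the limit
     because all [y n] are contractions. *)
  have t1 : tends ip (fun n => y n (y n x)) (Y (Y x)).
    have h1 : tends ip (fun n => y n (y n x - Y x)) 0.
      by apply: (tends0_le ler01 _ (YP x)) => n; rewrite mul1r.
    have := tendsD hH h1 (YP (Y x)); rewrite add0r => h e /h[N hN].
    by exists N => n /hN; rewrite (bopB (by_ n)) subrK.
  have t2 : tends ip (fun n => y n.+1 x) (Y x).
    by move=> e /(YP x)[N hN]; exists N => n hn; apply: hN; exact: leqW.
  have t3 := tendsD hH (bop_tends hH (bop_scale hH 2%:C (bop_id hH)) t2)
    (tends_cst hH (- K x)).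
  apply: (tends_uniq hH t1) => e /t3[N hN]; exists N => n /hN.
  rewrite /idop {1}/y sqrt_iterS scalerA -rmorphM divff ?pnatr_eq0 //= scale1r.
  by rewrite [K x + _]addrC addrK.
move=> S hS hSK x; apply: (tends_uniq hH (bop_tends hH hS (YP x))).
move=> e /(YP (S x))[N hN]; exists N => n /hN.
by rewrite (nnpoly_comm _ hS hSK (py n)).
Qed.

(** Rescaling by a constant [c] above the norm bound of [A] puts [K = 1 - A/c] between 0 and 1; then
    [B = c^(1/2) (1 - Y)]. Taking [c = r + 1] keeps [c] positive even for [r = 0]. *)
Lemma positive_sqrt_exists A : bop ip A -> ople ip (@zeroop R H) A ->
  exists B, [/\ bop ip B, ople ip (@zeroop R H) B, forall x, B (B x) = A x &
    forall S, bop ip S -> (forall x, S (A x) = A (S x)) -> forall x, S (B x) = B (S x)].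
Proof.
move=> hA pA; have sA := positive_symmetric hH hA pA.
have [r r0 hr] := bop_nrm hH hA; pose c := r + 1.
have c0 : 0 < c by rewrite /c; lra.
pose K x := x - (c^-1)%:C *: A x.
have hK : bop ip K by exact (bop_sub hH (bop_id hH) (bop_scale hH _ hA)).
have sK : symmetric_op ip K.
  by move=> x y; rewrite /K (ipBl hH) (ipBr hH) (ipZl hH) (ipZr_real hH) sA.
have pK : ople ip (@zeroop R H) K.
  apply: (symmetric_positive hH sK) => x.
  rewrite /K (ripBl hH) (ripZl hH) subr_ge0 ler_pdivrMl //.
  apply: le_trans (rip_le hH _ _) _; rewrite -(nrm_sqr hH).
  have := hr x; have := nrm_ge0 ip x; rewrite /c; nra.
have K1 x : rip ip (K x) x <= rip ip x x.
  rewrite /K (ripBl hH) (ripZl hH) lerBlDr lerDl.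
  by rewrite mulr_ge0 ?invr_ge0 ?(ltW c0) // (positive_rip hH).
have [Y [bY sY nY YY cY]] := sqrt_iter_limit hK pK K1.
pose s : R := Num.sqrt c.
have ss : s%:C * s%:C = c%:C by rewrite -rmorphM -expr2 sqr_sqrtr // ltW.
have bB : bop ip (fun x => s%:C *: (x - Y x)).
  exact (bop_scale hH _ (bop_sub hH (bop_id hH) bY)).
exists (fun x => s%:C *: (x - Y x)); split=> //.
- apply: (symmetric_positive hH) => [x y|x].
    by rewrite (ipZl hH) (ipZr_real hH) (ipBl hH) (ipBr hH) sY.
  rewrite (ripZl hH) (ripBl hH) mulr_ge0 ?sqrtr_ge0 // subr_ge0.
  apply: le_trans (rip_le hH _ _) _; rewrite -(nrm_sqr hH) expr2.
  by rewrite ler_wpM2r ?nrm_ge0.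
- move=> x; rewrite (bopZ bY) -scalerBr scalerA ss (bopB bY) YY.
  have -> : x - Y x - (Y x - (2%:C *: Y x - K x)) = x - K x.
    have -> : 2%:C *: Y x = Y x + Y x.
      by rewrite -[in RHS](scale1r (Y x)) -scalerDl -(rmorph1 (real_complex R)) -rmorphD.
    by rewrite opprB (addrAC (Y x + Y x)) addrK addrA subrK.
  by rewrite /K opprB addrC subrK scalerA -rmorphM divff ?gt_eqF // scale1r.
move=> S hS hSA x; rewrite (bopZ hS) (bopB hS) cY // => z.
by rewrite /K (bopB hS) (bopZ hS) hSA.
Qed.

(* Any other positive root commutes with [A], hence with the constructed root [B],
   so that [(B + B')(B - B') = 0]. *)
Lemma opsqrt_spec A : bop ip A -> ople ip (@zeroop R H) A ->
  [/\ bop ip (opsqrt ip A), ople ip (@zeroop R H) (opsqrt ip A),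
    forall x, opsqrt ip A (opsqrt ip A x) = A x &
    forall S, bop ip S -> (forall x, S (A x) = A (S x)) ->
      forall x, S (opsqrt ip A x) = opsqrt ip A (S x)].
Proof.
move=> hA pA; have [B [bB pB BB cB]] := positive_sqrt_exists hA pA.
have ex : exists S, bop ip S /\ ople ip (@zeroop R H) S /\ S \o S = A.
  by exists B; split=> //; split=> //; apply/funext.
have := epsilon_spec (inhabits (@idop R H)) _ ex; rewrite -/(opsqrt ip A).
set B' := opsqrt ip A => -[bB' [pB' BB'']].
have BB' x : B' (B' x) = A x by rewrite -BB''.
suff -> : B' = B by [].
have cBB' x : B' (B x) = B (B' x) by apply: cB => // z; rewrite -!BB'.
apply/funext => x; apply/eqP; rewrite -subr_eq0; apply/eqP/(rip_eq0 hH).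
pose z := B' x - B x.
have h0 : B' z + B z = 0.
  by rewrite /z (bopB bB') (bopB bB) BB' BB cBB' addrA subrK subrr.
have h1 : rip ip (B' z) z + rip ip (B z) z = 0 by rewrite -(ripDl hH) h0 (rip0l hH).
have p1 := positive_rip hH z pB'; have p2 := positive_rip hH z pB.
have z1 : B' z = 0 by apply: (positive_ker hH bB' pB'); lra.
have z2 : B z = 0 by apply: (positive_ker hH bB pB); lra.
rewrite -/z {2}/z (ripBr hH) /rip -(positive_symmetric hH bB' pB').
by rewrite -(positive_symmetric hH bB pB) z1 z2 !(ip0l hH) subrr.
Qed.

End SquareRoot.

(** * Projections, inverses and regularity *)

Section ProjectionsAndInverses.
Variables (R : realType) (H : lmodType R[i]) (ip : H -> H -> R[i]).
Hypothesis hH : is_hilbert ip.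
Implicit Types S A B P T W E : H -> H.

Definition is_proj P := [/\ bop ip P, forall x, P (P x) = P x & symmetric_op ip P].

Lemma symmetric_adj S : bop ip S -> symmetric_op ip S -> adj ip S = S.
Proof. by move=> hS sS; apply: (adj_uniq hH hS). Qed.

Lemma adj_symmetric S : bop ip S -> adj ip S = S -> symmetric_op ip S.
Proof. by move=> hS e x y; rewrite -{2}e (adjE hH hS). Qed.

(** Two projections with the same fixed vectors satisfy [QP = P] and [PQ = Q], and symmetry then
    makes them equal. *)
Lemma orthproj_uniq (M : H -> Prop) P : is_proj P -> (forall x, M x <-> P x = x) ->
  orthproj ip M = P.
Proof.
move=> [bP PP sP] MP.
have ex : exists Q, bop ip Q /\ Q \o Q = Q /\ adj ip Q = Q /\ forall x, M x <-> Q x = x.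
  exists P; split=> //; split; first exact/funext.
  by split=> //; exact: symmetric_adj.
have := epsilon_spec (inhabits (@idop R H)) _ ex; rewrite -/(orthproj ip M).
set Q := orthproj ip M => -[bQ [QQ [aQ MQ]]].
have sQ := adj_symmetric bQ aQ.
have QP x : Q (P x) = P x by apply/MQ/MP.
have PQ x : P (Q x) = Q x by apply/MP/MQ; exact: (congr1 (fun f => f x) QQ).
by apply/funext => x; apply: (ip_inj hH) => z; rewrite -sQ -PQ sP sQ QP.
Qed.

(** [P y] is the vector of [M] representing [<., y>] on [M]; uniqueness of that vector gives
    linearity and idempotence. *)
Lemma proj_exists (M : H -> Prop) :
  M 0 -> (forall a x y, M x -> M y -> M (a *: x + y)) ->
  (forall u l, (forall n, M (u n)) -> tends ip u l -> M l) ->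
  exists2 P, is_proj P & forall x, M x <-> P x = x.
Proof.
move=> M0 Mlin Mcl.
have ex y : exists u, M u /\ forall x, M x -> ip x y = ip x u.
  have [|||||u Mu hu] := @riesz_subspace _ _ _ hH M (fun x => ip x y) (nrm ip y) => //.
  - by move=> a x z; rewrite (ipDl hH) (ipZl hH).
  - by move=> x; rewrite mulrC; exact: (rip_le hH).
  by exists u.
have [P PP] := choice ex.
have MP y : M (P y) by case: (PP y).
have hP y x : M x -> ip x (P y) = ip x y by case: (PP y) => _ h /h.
have uniq y u : M u -> (forall x, M x -> ip x u = ip x y) -> P y = u.
  move=> Mu hu; apply/eqP; rewrite -subr_eq0; apply/eqP/(ip_eq0 hH).
  have Mz : M (P y - u).
    by have := Mlin (-1) _ _ Mu (MP y); rewrite scaleN1r addrC.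
  by rewrite {2}/GRing.add /= (ipBr hH) hP // hu // subrr.
have fixP x : M x -> P x = x by move=> hx; apply: uniq.
have sP : symmetric_op ip P.
  by move=> x y; rewrite -(hP y) // (ipC hH) (hP x) // -(ipC hH).
exists P; last by move=> x; split=> [/fixP|<-].
split=> //; last by move=> x; apply: fixP.
apply/(bopP hH); split=> [a x y|].
  apply: uniq => [|z hz]; first exact: Mlin.
  by rewrite !(ipDr hH) !(ipZr hH) !hP.
exists 1 => // x; rewrite mul1r nrm_le ?nrm_ge0 // (nrm_sqr hH).
have := rip_ge0 hH (x - P x); rewrite !(ripE hH) (ripC hH x).
have -> : rip ip (P x) x = rip ip (P x) (P x) by rewrite /rip hP.
lra.
Qed.

Lemma hclosure_ran_closed D (M := hclosure ip (ranop D)) : bop ip D ->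
  [/\ M 0, forall a x y, M x -> M y -> M (a *: x + y) &
      forall u l, (forall n, M (u n)) -> tends ip u l -> M l].
Proof.
have cl x : M x <-> forall e : R, 0 < e -> exists y, nrm ip (x - D y) < e.
  split=> h e.
    move=> e0; have [|_ [[y <-] hy]] := h e%:C; first by rewrite ltcR.
    by exists y; move: hy; rewrite (hnormE hH) ltcR.
  move=> /gt0C[t t0 ->]; have [y hy] := h t t0.
  by exists (D y); split; [exists y | rewrite (hnormE hH) ltcR].
move=> hD; split.
- by apply/cl => e e0; exists 0; rewrite (bop0 hD) subrr (nrm0 hH).
- move=> a x y /cl hx /cl hy; apply/cl => e e0.
  have [r r0 hr] := bop_nrm hH (bop_scale hH a (bop_id hH)).
  have r1 : 0 < r + 1 by lra.
  have e2 : 0 < e / 2 by lra.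
  have [x' hx'] := hx _ (divr_gt0 e2 r1).
  have [y' hy'] := hy _ e2.
  exists (a *: x' + y'); rewrite (bop_lin hD) opprD addrACA -scalerBr.
  apply: le_lt_trans (nrmD hH _ _) _.
  have := hr (x - D x'); rewrite /idop; move: hx'; rewrite ltr_pdivlMr //.
  have := nrm_ge0 ip (x - D x'); nra.
move=> u l hu ul; apply/cl => e e0.
have e2 : 0 < e / 2 by lra.
have [N hN] := ul _ e2; have /cl/(_ _ e2)[y hy] := hu N.
exists y; have := nrm_tri hH l (u N) (D y); have := hN N (leqnn N).
rewrite (nrmB hH l (u N)); lra.
Qed.

(** Lets one operator [P] express both projections of the theorem. If [D x = 0], then [P x] is
    orthogonal to the range of [D] and also approximated by it: [|P x|^2 = Re <P x - D y, P x>] can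
    be made arbitrarily small. *)
Lemma ran_ker_proj D : bop ip D -> symmetric_op ip D ->
  exists P, [/\ is_proj P, orthproj ip (hclosure ip (ranop D)) = P,
    orthproj ip (kerop D) = (fun x => x - P x) & forall x, D x = 0 <-> P x = 0].
Proof.
move=> hD sD; have [M0 Ml Mc] := hclosure_ran_closed hD.
have [P isP MP] := proj_exists M0 Ml Mc; have [bP PP sP] := isP.
have PD x : P (D x) = D x.
  apply/MP => e e0; exists (D x); split; first by exists x.
  by rewrite subrr (hnormE hH) (nrm0 hH).
have ker x : D x = 0 <-> P x = 0.
  split=> h; last by apply: (ip_inj hH) => z; rewrite -sD -PD sP h !(ip0r hH).
  apply: (rip_eq0 hH); apply: le_anti; rewrite rip_ge0 // andbT.
  apply/ler_addgt0Pr => e e0.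
  have s0 : 0 < nrm ip (P x) + 1 by have := nrm_ge0 ip (P x); lra.
  have /(_ (e / (nrm ip (P x) + 1))%:C) := (MP (P x)).2 (PP x).
  rewrite ltcR divr_gt0 // => /(_ isT)[_ [[y <-]]].
  rewrite (hnormE hH) ltcR ltr_pdivlMr // => hy.
  have e1 : rip ip (P x) (P x) = rip ip (P x - D y) (P x).
    rewrite (ripBl hH); have -> : rip ip (D y) (P x) = 0.
      by rewrite /rip -sP PD sD h (ip0r hH).
    by rewrite subr0.
  rewrite e1; apply: le_trans (rip_le hH _ _) _.
  have := nrm_ge0 ip (P x - D y); have := nrm_ge0 ip (P x); nra.
exists P; split=> //; first exact: orthproj_uniq.
apply: orthproj_uniq; first split.
- exact (bop_sub hH (bop_id hH) bP).
- by move=> x; rewrite (bopB bP) PP subrr subr0.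
- by move=> x y; rewrite (ipBl hH) (ipBr hH) sP.
move=> x; rewrite /kerop ker; split=> [->|h]; first by rewrite subr0.
by rewrite -h (bopB bP) PP subrr.
Qed.

(* A vector [u] with [T^*T u = y] is the Riesz representative of [<., y>] for the
   inner product [<Tx, Ty>], which is complete because [T] is bounded below. *)
Lemma opinv_spec T : bop ip T -> (forall x, nrm ip x <= nrm ip (T x)) ->
  let G := opinv ip (adj ip T \o T) in
  [/\ bop ip G, forall x, adj ip T (T (G x)) = x & forall x, G (adj ip T (T x)) = x].
Proof.
move=> hT lo G; have [r r0 hr] := bop_nrm hH hT.
pose ip2 x y := ip (T x) (T y).
have hH2 : is_hilbert ip2.
  have n2 x : nrm ip2 x = nrm ip (T x) by [].
  have base : forall u, (forall e : R, 0 < e -> exists N, forall m n, (N <= m)%N ->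
      (N <= n)%N -> nrm ip2 (u m - u n) < e) -> exists l, tends ip2 u l.
    move=> u hu; have [|l hl] := hilbert_complete hH (u := u).
      move=> e /hu[N hN]; exists N => m n hm hn.
      exact: le_lt_trans (lo _) (hN m n hm hn).
    exists l => e /(bop_tends hH hT hl)[N hN]; exists N => n /hN.
    by rewrite n2 (bopB hT).
  have ge0 x : 0 <= ip2 x x by exact: (ip_ge0 hH).
  have h2 x : hnorm ip2 x = (nrm ip2 x)%:C by rewrite n2 -(hnormE hH).
  split=> //.
  - by move=> a x y z; rewrite /ip2 (bop_lin hT) (ipDl hH) (ipZl hH).
  - by move=> x y; rewrite /ip2 (ipC hH).
  - move=> x /(ip_eq0 hH) h; apply: (nrm_eq0 hH); apply: le_anti.
    by rewrite nrm_ge0 andbT; apply: le_trans (lo x) _; rewrite h (nrm0 hH).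
  move=> u hu; have [|l hl] := base u.
    move=> e e0; have [|N hN] := hu e%:C; first by rewrite ltcR.
    by exists N => m n hm hn; have := hN m n hm hn; rewrite h2 ltcR.
  exists l => _ /gt0C[t t0 ->]; have [N hN] := hl t t0.
  by exists N => n /hN; rewrite h2 ltcR.
have ex y : exists u, adj ip T (T u) = y.
  have [|||||u _ hu] :=
    @riesz_subspace _ _ _ hH2 (fun=> True) (fun x => ip x y) (nrm ip y) => //.
  - by move=> a x z; rewrite (ipDl hH) (ipZl hH).
  - move=> x; apply: le_trans (rip_le hH _ _) _; rewrite mulrC ler_wpM2l ?nrm_ge0 //.
  by exists u; apply: (ip_inj hH) => z; rewrite -(adjE hH hT) hu.
have inj x y : adj ip T (T x) = adj ip T (T y) -> x = y.
  move=> h; apply/eqP; rewrite -subr_eq0; apply/eqP/(nrm_eq0 hH)/le_anti.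
  rewrite nrm_ge0 andbT; apply: le_trans (lo _) _; rewrite nrm_le // expr0n /=.
  by rewrite /rip (adjE hH hT) (bopB hT) (bopB (bop_adj hH hT)) h subrr (ip0r hH).
have [F FP] := choice ex.
have bF : bop ip F.
  apply/(bopP hH); split=> [a x y|].
    by apply: inj; rewrite (bop_lin hT) (bop_lin (bop_adj hH hT)) !FP.
  (* [|F x|^2 <= |T (F x)|^2 = Re <F x, x> <= |F x| |x|]. *)
  exists 1 => // x; rewrite mul1r.
  have := lo (F x); rewrite nrm_le ?nrm_ge0 // (nrm_sqr hH) /rip (adjE hH hT) FP.
  move/le_trans => /(_ _ (rip_le hH _ _)); rewrite -/(rip ip _ _) -(nrm_sqr hH) expr2.
  have := nrm_ge0 ip (F x); have := nrm_ge0 ip x => x0 F0 h.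
  rewrite leNgt; apply/negP => lt; nra.
have exG : exists B, bop ip B /\ (adj ip T \o T) \o B = @idop R H /\
    B \o (adj ip T \o T) = @idop R H.
  exists F; split=> //; split; apply/funext => x; first exact: FP.
  by apply: inj; rewrite /= FP.
have [bG [h1 h2]] := epsilon_spec (inhabits (@idop R H)) _ exG.
split=> // x; first by have := congr1 (fun f => f x) h1.
by have := congr1 (fun f => f x) h2.
Qed.

Lemma proj_nrm P x : is_proj P -> nrm ip (P x) <= nrm ip x.
Proof.
move=> [bP PP sP]; rewrite nrm_le ?nrm_ge0 // (nrm_sqr hH).
have := rip_ge0 hH (x - P x); rewrite !(ripE hH) (ripC hH x).
have -> : rip ip (P x) x = rip ip (P x) (P x) by rewrite /rip sP [in RHS]sP PP.
lra.
Qed.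

(** * Block structure relative to a projection *)

Lemma ker_proj_absorb A P : bop ip A -> symmetric_op ip A -> is_proj P ->
  (forall x, P x = 0 -> A x = 0) -> (forall x, A (P x) = A x) * (forall x, P (A x) = A x).
Proof.
move=> hA sA [bP PP sP] k.
have h x : A (P x) = A x.
  apply/esym/eqP; rewrite -subr_eq0 -(bopB hA); apply/eqP/k.
  by rewrite (bopB bP) PP subrr.
by split=> // x; apply: (ip_inj hH) => z; rewrite -sP -!sA h.
Qed.

Lemma ker_block P W x : is_proj P -> bop ip W -> (forall x, P x = 0 -> P (W x) = 0) ->
  P (W (P x)) = P (W x).
Proof.
move=> [bP PP sP] hW inv.
apply/esym/eqP; rewrite -subr_eq0 -(bopB bP) -(bopB hW); apply/eqP/inv.
by rewrite (bopB bP) PP subrr.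
Qed.

Lemma bop_compress S A B : bop ip S -> bop ip A -> bop ip B -> bop ip (S \o A \o B).
Proof. by move=> hS hA hB; exact: (bop_comp hH (bop_comp hH hS hA) hB). Qed.

Lemma Aregular_iff A P W : bop ip A -> ople ip (@zeroop R H) A -> is_proj P ->
  (forall x, A x = 0 <-> P x = 0) -> bop ip W -> (forall x, P x = 0 -> P (W x) = 0) ->
  Aregular ip A W <-> forall x, A (P (W (P x))) = P (W (P (A x))).
Proof.
move=> hA pA isP ker hW inv; have [bP PP sP] := isP.
have [bB pB BB cB] := opsqrt_spec hH hA pA.
rewrite /Aregular; set B := opsqrt ip A in bB pB BB cB *.
have sB := positive_symmetric hH bB pB; have sA := positive_symmetric hH hA pA.
have kB x : B x = 0 <-> P x = 0.
  rewrite -ker -BB; split=> [->|h]; first exact: (bop0 bB).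
  by apply: (rip_eq0 hH); rewrite /rip sB h (ip0r hH).
have [BP PB] := ker_proj_absorb bB sB isP (fun x => (kB x).2).
have [AP PA] := ker_proj_absorb hA sA isP (fun x => (ker x).2).
have WP x := ker_block x isP hW inv.
split=> [reg x|com].
  (* Regularity reads [B (B W - W B) = 0]. As [ker B = ker P], the bracket is killed by [P], and
     [P B = B]. *)
  have cBW y : B (W y) = P (W (B y)).
    have : B (B (W y) - W (B y)) = 0.
      by rewrite (bopB bB) BB; have /= -> := congr1 (fun f => f y) reg; rewrite subrr.
    by move/kB; rewrite (bopB bP) PB => /eqP; rewrite subr_eq0 => /eqP.
  have cBS y : B (P (W (P y))) = P (W (P (B y))) by rewrite BP cBW BP PB.
  by rewrite -BB !cBS BB.
have hS : bop ip (P \o W \o P) by apply: bop_compress.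
have cBS := cB _ hS (fun x => esym (com x)).
by apply/funext => x /=; rewrite -BB -(BP (W x)) -WP -cBS /= PB BP.
Qed.

Lemma adj_compression P W : is_proj P -> bop ip W ->
  adj ip (P \o W \o P) = P \o adj ip W \o P.
Proof.
move=> [bP PP sP] hW; apply: (adj_uniq hH) => [|x y /=].
  by apply: bop_compress.
by rewrite sP (adjE hH hW) sP.
Qed.

Lemma quasinormalP S : quasinormal ip S <->
  forall x, S (adj ip S (S x)) = adj ip S (S (S x)).
Proof.
split=> [h x|h]; last by apply/funext => x; exact: h.
by have := congr1 (fun f => f x) h.
Qed.

(* Writing [Z = (1 - P)WP] and [S = PWP], one has [Z^*Z + S^*S = PW^*WP]. *)
Lemma commute_defect_iff P W (S := P \o W \o P) (Z := (fun x => x - P x) \o W \o P) :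
  is_proj P -> bop ip W ->
  (forall x, S (P (adj ip W (W (P x)))) = P (adj ip W (W (P (S x))))) ->
  commute_op S (adj ip Z \o Z) <-> quasinormal ip S.
Proof.
move=> isP hW com; have [bP PP sP] := isP.
have hS : bop ip S by apply: bop_compress.
have hQ : bop ip (fun x => x - P x) by exact (bop_sub hH (bop_id hH) bP).
have hZ : bop ip Z by apply: bop_compress.
have bW := bop_adj hH hW.
have ZZ x : adj ip Z (Z x) = P (adj ip W (W (P x))) - adj ip S (S x).
  rewrite adj_compression //= PP.
  apply: (ip_inj hH) => z; rewrite -(adjE hH hZ) /Z /=.
  have r u : ip z (P (adj ip W u)) = ip (W (P z)) u by rewrite -sP -(adjE hH hW).
  rewrite [in RHS](ipBr hH) !r (ipBl hH) !(ipBr hH) [ip (P _) (P _)]sP PP.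
  by rewrite sP subrr subr0.
have E x : S (adj ip Z (Z x)) - adj ip Z (Z (S x)) =
    adj ip S (S (S x)) - S (adj ip S (S x)).
  by rewrite !ZZ (bopB hS) com opprB addrC addrA subrK.
split=> [h|/quasinormalP h].
  apply/quasinormalP => x; apply/esym/eqP; rewrite -subr_eq0 -E.
  by have /= -> := congr1 (fun f => f x) h; rewrite subrr.
by apply/funext => x /=; apply/eqP; rewrite -subr_eq0 E h subrr.
Qed.

(** Both sides of the identity for [S \o G] are those for [S] followed by a factor [G^3], which
    evaluation at [L (L (L x))] cancels. *)
Lemma quasinormal_comp_iff S G L : bop ip S -> bop ip G -> symmetric_op ip G ->
  (forall x, S (G x) = G (S x)) -> (forall x, adj ip S (G x) = G (adj ip S x)) ->
  (forall x, G (L x) = x) -> quasinormal ip (S \o G) <-> quasinormal ip S.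
Proof.
move=> hS hG sG c c' GL.
rewrite !quasinormalP adj_comp // (symmetric_adj hG sG) /=.
split=> h x; last by rewrite !(c, c') h.
by have := h (L (L (L x))); rewrite -!(c, c') !GL.
Qed.

Lemma adj_commute S E : bop ip S -> symmetric_op ip E ->
  (forall x, S (E x) = E (S x)) -> forall x, adj ip S (E x) = E (adj ip S x).
Proof.
move=> hS sE c x; apply: (ip_inj hH) => z.
by rewrite -(adjE hH hS) -!sE -(adjE hH hS) c.
Qed.

(** Since [E] commutes with [S] and [S^*], the commutator [A S - S A] is [E (S^*S S - S S^*S)], and
    [E] is injective on the range of [P]. Applied to [Delta_(T^2)] with [E = D], and to [D_(T'^2)^2]
    with [E = 1 - G] and [S \o G] in the place of [S]. *)
Lemma commute_sum_iff S E P A : is_proj P -> bop ip S -> bop ip E -> symmetric_op ip E ->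
  (forall x, E x = 0 <-> P x = 0) -> (forall x, P (S x) = S x) ->
  (forall x, P (adj ip S x) = adj ip S x) ->
  (forall x, S (E x) = E (S x)) -> (forall x, A x = E x + adj ip S (E (S x))) ->
  (forall x, A (S x) = S (A x)) <-> quasinormal ip S.
Proof.
move=> [bP PP sP] hS hE sE ker PS PS' c AE.
have c' := adj_commute hS sE c.
have dE x : A (S x) - S (A x) = E (adj ip S (S (S x)) - S (adj ip S (S x))).
  by rewrite !AE !c' (bopD hS) !c (bopB hE) opprD addrACA subrr add0r.
rewrite quasinormalP; split=> h x.
  apply/esym/eqP; rewrite -subr_eq0; apply/eqP.
  have : P (adj ip S (S (S x)) - S (adj ip S (S x))) = 0.
    by apply/ker; rewrite -dE h subrr.
  by rewrite (bopB bP) PS PS'.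
by apply/eqP; rewrite -subr_eq0 dE h subrr (bop0 hE).
Qed.

End ProjectionsAndInverses.

(** * Concave operators *)

(** The increments decrease, so a block of [m] steps gains most at the start. For [a n = |T^n x|^2]
    this is the asserted contraction inequality. *)
Lemma concave_seq (R : realType) (a : nat -> R) :
  (forall n, a n.+2 - 2 * a n.+1 + a n <= 0) ->
  forall m n, a (m + n)%N - a n <= a m - a 0%N.
Proof.
move=> h.
have d n k : a (k + n).+1 - a (k + n)%N <= a k.+1 - a k.
  by elim: n => [|n IH]; rewrite ?addn0 // addnS; have := h (k + n)%N; lra.
by move=> m n; elim: m => [|m IH]; rewrite ?subrr // addSn; have := d n m; lra.
Qed.

Lemma concave_seq_nondecreasing (R : realType) (a : nat -> R) :
  (forall n, a n.+2 - 2 * a n.+1 + a n <= 0) -> (forall n, 0 <= a n) -> a 0%N <= a 1%N.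
Proof.
move=> h a0; rewrite leNgt; apply/negP => lt.
have b n : a n <= a 0%N + n%:R * (a 1%N - a 0%N).
  elim: n => [|n IH]; first by rewrite mul0r addr0.
  by have := concave_seq h 1 n; rewrite add1n -natr1 mulrDl mul1r; lra.
(* [q] is where the line [a 0 + n (a 1 - a 0)], which dominates the sequence, crosses zero. *)
pose q := a 0%N / (a 0%N - a 1%N).
have q0 : 0 <= q by apply: divr_ge0 => //; lra.
have := archi_boundP q0; rewrite /q ltr_pdivrMr; last by lra.
have := b (Num.bound q); have := a0 (Num.bound q); rewrite -/q; lra.
Qed.

Section ConcaveOperators.
Variables (R : realType) (H : lmodType R[i]) (ip : H -> H -> R[i]).
Hypothesis hH : is_hilbert ip.
Implicit Types S A T W : H -> H.

Lemma bop_Delta A : bop ip A -> bop ip (Delta ip A).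
Proof.
by move=> hA; exact (bop_sub hH (bop_comp hH (bop_adj hH hA) hA) (bop_id hH)).
Qed.

Lemma bop_Dsq A : bop ip A -> bop ip (Dsq ip A).
Proof.
by move=> hA; exact (bop_sub hH (bop_id hH) (bop_comp hH (bop_adj hH hA) hA)).
Qed.

Lemma symmetric_Delta A : bop ip A -> symmetric_op ip (Delta ip A).
Proof.
move=> hA x y; rewrite /Delta (ipBl hH) (ipBr hH) (adjE' hH hA).
by rewrite -(adjE hH hA).
Qed.

Lemma symmetric_Dsq A : bop ip A -> symmetric_op ip (Dsq ip A).
Proof.
move=> hA x y; rewrite /Dsq (ipBl hH) (ipBr hH) (adjE' hH hA).
by rewrite -(adjE hH hA).
Qed.

Lemma Delta_form A x : bop ip A ->
  ip (Delta ip A x) x = (rip ip (A x) (A x) - rip ip x x)%:C.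
Proof.
by move=> hA; rewrite /Delta (ipBl hH) (adjE' hH hA) !(ipxx hH) rmorphB.
Qed.

Lemma Dsq_form A x : bop ip A ->
  ip (Dsq ip A x) x = (rip ip x x - rip ip (A x) (A x))%:C.
Proof.
by move=> hA; rewrite /Dsq (ipBl hH) (adjE' hH hA) !(ipxx hH) rmorphB.
Qed.

Lemma Dsq_positive A : bop ip A -> (forall x, nrm ip (A x) <= nrm ip x) ->
  ople ip (@zeroop R H) (Dsq ip A).
Proof.
move=> hA con x; rewrite (ip0l hH) Dsq_form // ler0c subr_ge0.
by have := con x; rewrite nrm_le ?nrm_ge0 // (nrm_sqr hH).
Qed.

Lemma Dsq_ker A x : bop ip A -> (forall x, nrm ip (A x) <= nrm ip x) ->
  Dsq ip A x = 0 <-> rip ip (A x) (A x) = rip ip x x.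
Proof.
move=> hA con; split=> [h|h].
  by have := Dsq_form x hA; rewrite h (ip0l hH) => -[/esym/eqP]; rewrite subr_eq0 => /eqP.
apply: (positive_ker hH (bop_Dsq hA) (Dsq_positive hA con)).
by rewrite /rip Dsq_form //= h subrr.
Qed.

Definition orbit_sq T x n := rip ip (opow T n x) (opow T n x).

Variables (T : H -> H) (hT : bop ip T) (hconc : concave ip T).

(** Concavity of [T] evaluated at the vector [T^n x]. *)
Lemma concave_orbit x n : orbit_sq T x n.+2 - 2 * orbit_sq T x n.+1 + orbit_sq T x n <= 0.
Proof.
have := hconc (opow T n x); have h2 := bop_opow hH 2 hT.
rewrite (ip0l hH) !(ipDl hH) (ipNl hH) (ipZl hH) (adjE' hH h2) (adjE' hH hT).
rewrite !(ipxx hH) lecE => /andP[_]; rewrite /orbit_sq !ReD ReN.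
have -> : (2%:R : R[i]) = (2 : R)%:C by rewrite rmorph_nat.
by rewrite ReZ /=.
Qed.

Lemma concave_expansive x : rip ip x x <= rip ip (T x) (T x).
Proof.
exact: (concave_seq_nondecreasing (concave_orbit x) (fun n => rip_ge0 hH _)).
Qed.

Lemma concave_orbit_mono x n : rip ip x x <= orbit_sq T x n.
Proof.
by elim: n => [|n IH] //; apply: le_trans IH _; exact: concave_expansive.
Qed.

Lemma concave_Delta_positive n : ople ip (@zeroop R H) (Delta ip (opow T n)).
Proof.
move=> x; rewrite (ip0l hH) (Delta_form _ (bop_opow hH n hT)) ler0c subr_ge0.
exact: concave_orbit_mono.
Qed.

Lemma concave_Delta_ker n x :
  Delta ip (opow T n) x = 0 <-> orbit_sq T x n = rip ip x x.
Proof.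
have hn := bop_opow hH n hT; split=> [h|h].
  by have := Delta_form x hn; rewrite h (ip0l hH) => -[/esym/eqP]; rewrite subr_eq0 => /eqP.
apply: (positive_ker hH (bop_Delta hn) (concave_Delta_positive n)).
by rewrite /rip Delta_form //= -/(orbit_sq T x n) h subrr.
Qed.

Lemma concave_Acontraction m n :
  Acontraction ip (Delta ip (opow T m)) (opow T n).
Proof.
move=> x; have hn := bop_opow hH n hT; have hm := bop_opow hH m hT.
rewrite (adjE' hH hn) !Delta_form // lecR.
have := concave_seq (concave_orbit x) m n; by rewrite /orbit_sq opowD.
Qed.

(** Membership in the kernel means that the squared orbit norms agree at 0 and [n]. A zero first
    increment excludes later growth by concavity; conversely monotonicity squeezes the value at 1
    between those at 0 and [n]. *)
Lemma concave_ker_opow n x : (1 <= n)%N ->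
  Delta ip T x = 0 <-> Delta ip (opow T n) x = 0.
Proof.
move=> n1; rewrite (concave_Delta_ker n) (concave_Delta_ker 1).
have e := concave_expansive x; case: n n1 => // n _; split=> h.
  apply: le_anti; rewrite concave_orbit_mono andbT.
  move: (h); rewrite -[X in _ = X]/(orbit_sq T x 0) => h0.
  elim: n => [|n IH]; first by rewrite h.
  have := concave_seq (concave_orbit x) 1 n.+1; rewrite add1n h0; move: IH; lra.
apply: le_anti; rewrite concave_orbit_mono andbT -h.
have := concave_orbit_mono (T x) n; rewrite /orbit_sq.
by rewrite -[T x]/(opow T 1 x) -opowD addn1.
Qed.

Lemma concave_ker_invariant x : Delta ip T x = 0 -> Delta ip T (T x) = 0.
Proof.
rewrite !(concave_Delta_ker 1) => h; apply: le_anti.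
rewrite concave_orbit_mono andbT; have := concave_orbit x 0.
move: h; rewrite /orbit_sq /=; rewrite /idop; lra.
Qed.

End ConcaveOperators.

(** * Regular concave operators *)

Section RegularConcave.
Variables (R : realType) (H : lmodType R[i]) (ip : H -> H -> R[i]).
Hypothesis hH : is_hilbert ip.
Variables (T : H -> H) (hT : bop ip T) (hconc : concave ip T).
Variable P : H -> H.
Hypotheses (isP : is_proj ip P) (kerP : forall x, Delta ip T x = 0 <-> P x = 0).
Local Notation D := (Delta ip T).
Local Notation G := (opinv ip (adj ip T \o T)).

(* [S = PWP = PW] gives [W^* P = S^* P]. *)
Lemma adj_block W A x : bop ip W -> (forall x, P x = 0 -> P (W x) = 0) ->
  (forall x, A (P x) = A x) -> (forall x, P (A x) = A x) ->
  adj ip W (A (W x)) = adj ip (P \o W \o P) (A ((P \o W \o P) x)).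
Proof.
move=> hW inv AP PA; have [bP PP sP] := isP.
have hS := bop_compress hH bP hW bP.
apply: (ip_inj hH) => z; rewrite -(adjE hH hW) -(adjE hH hS) /= !(ker_block _ isP) //.
by rewrite AP [RHS]sP PA.
Qed.

Lemma concave_inv x : P x = 0 -> P (T x) = 0.
Proof. by move=> /kerP/(concave_ker_invariant hH hT hconc)/kerP. Qed.

Lemma concave_opow_inv n x : P x = 0 -> P (opow T n x) = 0.
Proof. by move=> h; elim: n => //= n IH; exact: concave_inv. Qed.

Lemma ker_opow n x : Delta ip (opow T n.+1) x = 0 <-> P x = 0.
Proof. by rewrite -kerP -(concave_ker_opow hH hT hconc). Qed.

Hypothesis reg : Aregular ip D T.
Local Notation S := (P \o T \o P).

Lemma bop_compressT : bop ip S.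
Proof. by case: isP => bP _ _; exact: (bop_compress hH bP hT bP). Qed.

Lemma Delta_absorb : (forall x, D (P x) = D x) * (forall x, P (D x) = D x).
Proof.
apply: (ker_proj_absorb hH (bop_Delta hH hT) (symmetric_Delta hH hT) isP) => x.
by move/kerP.
Qed.

Lemma compress_comm_Delta x : S (D x) = D (S x).
Proof.
have pD := concave_Delta_positive hH hT hconc 1.
have := (Aregular_iff hH (bop_Delta hH hT) pD isP kerP hT concave_inv).1 reg x.
by move=> ->.
Qed.

(** From [T^(m+2) = T^(m+1) T] one gets [D + T^* Delta T], and [T] may be replaced by [S] because
    the inner defect operator is absorbed by [P]. The exponent starts at 1, where that operator has
    kernel [ker P]. *)
Lemma concave_Delta_rec m x :
  Delta ip (opow T m.+2) x = D x + adj ip S (Delta ip (opow T m.+1) (S x)).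
Proof.
have hm := bop_opow hH m.+1 hT.
have [AP PA] := ker_proj_absorb hH (bop_Delta hH hm) (symmetric_Delta hH hm) isP
  (fun x => (ker_opow m x).2).
rewrite -adj_block //; last exact: concave_inv.
have -> : opow T m.+2 = opow T m.+1 \o T by apply/funext => y; rewrite opowE iterSr -opowE.
rewrite /Delta (adj_comp hH hm hT) (bopB (bop_adj hH hT)) /=.
by rewrite [RHS]addrC addrA subrK.
Qed.

Lemma regular_quasinormal_iff :
  (forall m n : nat, (1 <= m)%N -> (1 <= n)%N ->
     Aregular ip (Delta ip (opow T m)) (opow T n)) <-> quasinormal ip S.
Proof.
have [bP PP sP] := isP.
have Areg m n : Aregular ip (Delta ip (opow T m.+1)) (opow T n) <->
    forall x, Delta ip (opow T m.+1) (P (opow T n (P x))) =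
              P (opow T n (P (Delta ip (opow T m.+1) x))).
  apply: Aregular_iff => //.
  - exact/(bop_Delta hH)/bop_opow.
  - exact: concave_Delta_positive.
  - exact: ker_opow.
  - exact: bop_opow.
  - exact: concave_opow_inv.
have PS x : P (S x) = S x by exact: PP.
have PS' x : P (adj ip S x) = adj ip S x by rewrite (adj_compression hH isP hT) /= PP.
have crit := commute_sum_iff hH isP bop_compressT (bop_Delta hH hT) (symmetric_Delta hH hT)
  kerP PS PS' compress_comm_Delta (concave_Delta_rec 0).
split=> [h|/[dup] /quasinormalP qn q].
  (* Regularity for [m = 2], [n = 1] says that [S] commutes with [Delta_(T^2) = D + S^* D S]. *)
  by apply/crit => x; have /Areg := h 2%N 1%N isT isT; exact.
have comm m x : Delta ip (opow T m.+1) (S x) = S (Delta ip (opow T m.+1) x).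
  elim: m x => [|m IH] x; first by rewrite compress_comm_Delta.
  have sm := symmetric_Delta hH (bop_opow hH m.+1 hT).
  have c' := adj_commute hH bop_compressT sm (fun x => esym (IH x)).
  rewrite !concave_Delta_rec (bopD bop_compressT) compress_comm_Delta; congr (_ + _).
  (* [S] and [S^*] commute with the inner defect operator, so what remains is exactly the
     quasinormality identity. *)
  by rewrite !c' -IH qn.
(* Invariance of [ker P] makes [T] block triangular, so the compression of a power is the power of
   the compression. *)
have pow n x : P (opow T n (P x)) = iter n S (P x).
  elim: n => [|n IH] /=; first exact: PP.
  rewrite -IH /= PP (ker_block _ isP) //; exact: concave_inv.
case=> // m n _ _; apply/Areg => x; rewrite !pow.
have hm := bop_opow hH m.+1 hT.
have [AP PA] := ker_proj_absorb hH (bop_Delta hH hm) (symmetric_Delta hH hm) isP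
  (fun x => (ker_opow m x).2).
by rewrite PA -[in RHS]AP; elim: n => //= n <-; rewrite comm.
Qed.

(** Here [P T^*T P = P + D], which commutes with [S]. *)
Lemma commute_offdiag_iff :
  commute_op S (adj ip ((fun x => x - P x) \o T \o P) \o ((fun x => x - P x) \o T \o P))
  <-> quasinormal ip S.
Proof.
have [bP PP sP] := isP; have [DP PD] := Delta_absorb.
have TT x : P (adj ip T (T (P x))) = P x + D x.
  have -> : adj ip T (T (P x)) = D (P x) + P x by rewrite /Delta subrK.
  by rewrite DP (bopD bP) PD PP addrC.
apply: (commute_defect_iff hH isP hT) => x; rewrite !TT (bopD bop_compressT) compress_comm_Delta.
by rewrite /= !PP.
Qed.

Lemma expansive_nrm x : nrm ip x <= nrm ip (T x).
Proof. by rewrite nrm_le ?nrm_ge0 // (nrm_sqr hH); exact: (concave_expansive hH hT). Qed.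

Lemma bop_gram_inv : bop ip G.
Proof. by case: (opinv_spec hH hT expansive_nrm). Qed.

Lemma gramK x : adj ip T (T (G x)) = x.
Proof. by case: (opinv_spec hH hT expansive_nrm). Qed.

Lemma gram_invK x : G (adj ip T (T x)) = x.
Proof. by case: (opinv_spec hH hT expansive_nrm). Qed.

Lemma symmetric_gram_inv : symmetric_op ip G.
Proof.
move=> x y; rewrite -{2}(gramK x) (adjE' hH hT) (adjE hH hT).
by rewrite gramK.
Qed.

Lemma comm_gram_inv W x : bop ip W -> (forall x, W (D x) = D (W x)) -> W (G x) = G (W x).
Proof.
move=> hW c; have c2 y : W (adj ip T (T y)) = adj ip T (T (W y)).
  have -> z : adj ip T (T z) = D z + z by rewrite /Delta subrK.
  by rewrite (bopD hW) c /Delta subrK.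
by rewrite -{2}(gramK x) c2 gram_invK.
Qed.

Lemma proj_comm_gram_inv x : P (G x) = G (P x).
Proof.
by have [bP _ _] := isP; apply: comm_gram_inv => // y; rewrite Delta_absorb.1 Delta_absorb.2.
Qed.

Lemma compress_comm_gram_inv x : S (G x) = G (S x).
Proof. by apply: comm_gram_inv; [exact: bop_compressT | exact: compress_comm_Delta]. Qed.

(** * The Cauchy dual and its defect operators *)

Local Notation T' := (cdual ip T).

Lemma bop_cdual : bop ip T'.
Proof. exact: (bop_comp hH hT bop_gram_inv). Qed.

Lemma cdual_inv x : P x = 0 -> P (T' x) = 0.
Proof.
move=> h; apply: concave_inv.
by rewrite proj_comm_gram_inv h (bop0 bop_gram_inv).
Qed.

Lemma compress_cdual : P \o T' \o P = S \o G.
Proof.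
have [bP PP sP] := isP; apply/funext => x.
by rewrite /cdual /= -proj_comm_gram_inv.
Qed.

Lemma adj_cdual : adj ip T' = G \o adj ip T.
Proof.
rewrite (adj_comp hH hT bop_gram_inv) (symmetric_adj hH bop_gram_inv) //; exact: symmetric_gram_inv.
Qed.

Lemma cdual_gram x : adj ip T' (T' x) = G x.
Proof. by rewrite adj_cdual /= gram_invK. Qed.

(** Put [g = G x] and [d = D g], so that [x = g + d]. Then [|T'x|^2 = <g, g + d>], which is at most
    [|g + d|^2] because [<d, g> >= 0]. *)
Lemma cdual_nrm x : nrm ip (T' x) <= nrm ip x.
Proof.
rewrite nrm_le ?nrm_ge0 // (nrm_sqr hH).
have e : x = G x + D (G x) by rewrite /Delta addrC subrK gramK.
have -> : rip ip (T' x) (T' x) = rip ip (G x) x.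
  by rewrite /rip (ipC hH) (adjE hH bop_cdual) cdual_gram -(ipC hH).
have key g d : 0 <= rip ip d g -> rip ip g (g + d) <= rip ip (g + d) (g + d).
  by rewrite !(ripE hH) (ripC hH g d); have := rip_ge0 hH d; lra.
have := key _ _ (positive_rip hH (G x) (concave_Delta_positive hH hT hconc 1)).
by rewrite -[Delta ip (opow T 1) _]/(D (G x)) -e.
Qed.

Lemma quasinormal_cdual_iff : quasinormal ip (S \o G) <-> quasinormal ip S.
Proof.
apply: (quasinormal_comp_iff hH bop_compressT bop_gram_inv symmetric_gram_inv compress_comm_gram_inv _ (L := adj ip T \o T)).
  exact: (adj_commute hH bop_compressT symmetric_gram_inv compress_comm_gram_inv).
exact: gram_invK.
Qed.

(** Here [P T'^*T' P = P G P], which commutes with [S \o G]. *)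
Lemma commute_offdiag_cdual_iff :
  commute_op (S \o G)
    (adj ip ((fun x => x - P x) \o T' \o P) \o ((fun x => x - P x) \o T' \o P))
  <-> quasinormal ip (S \o G).
Proof.
have [bP PP sP] := isP.
rewrite -compress_cdual; apply: (commute_defect_iff hH isP bop_cdual) => x.
rewrite !cdual_gram compress_cdual /= -!proj_comm_gram_inv !PP [RHS]proj_comm_gram_inv.
exact: (compress_comm_gram_inv (G x)).
Qed.

Local Notation E := (Dsq ip T').

Lemma Dsq_cdualE x : E x = x - G x.
Proof. by rewrite /Dsq cdual_gram. Qed.

(** [E = 1 - G = G D] with [G] invertible. *)
Lemma Dsq_cdual_ker x : E x = 0 <-> P x = 0.
Proof.
rewrite -kerP Dsq_cdualE -{1}(gram_invK x) -(bopB bop_gram_inv) -/(Delta ip T x).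
split=> [h|->]; last exact: (bop0 bop_gram_inv).
by rewrite -(gramK (D x)) h (bop0 hT) (bop0 (bop_adj hH hT)).
Qed.

Lemma compress_cdual_comm_Dsq x : (S \o G) (E x) = E ((S \o G) x).
Proof.
rewrite !Dsq_cdualE (bopB (bop_comp hH bop_compressT bop_gram_inv)); congr (_ - _).
exact: (compress_comm_gram_inv (G x)).
Qed.

Lemma Dsq_cdual_absorb : (forall x, E (P x) = E x) * (forall x, P (E x) = E x).
Proof.
apply: (ker_proj_absorb hH (bop_Dsq hH bop_cdual) (symmetric_Dsq hH bop_cdual) isP) => x.
by move/Dsq_cdual_ker.
Qed.

Lemma Dsq_cdual2 x : Dsq ip (opow T' 2) x = E x + adj ip (S \o G) (E ((S \o G) x)).
Proof.
have [EP PE] := Dsq_cdual_absorb; have bT' := bop_cdual.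
rewrite -compress_cdual -adj_block //; last exact: cdual_inv.
have -> : opow T' 2 = T' \o T' by [].
rewrite /Dsq (adj_comp hH bT' bT') /= (bopB (bop_adj hH bT')).
by rewrite addrA subrK.
Qed.

Lemma cdual2_nrm x : nrm ip (opow T' 2 x) <= nrm ip x.
Proof. exact: le_trans (cdual_nrm _) (cdual_nrm _). Qed.

(** Expanded in norms and rearranged, the claim becomes [<E T'^2 x, T'^2 x> <= <E x, x>]. Since
    [E = P E P], [T'] may be replaced there by the contraction [S \o G], which commutes with [E] and
    hence with its square root [B], so that [|B (SG)^2 x| = |(SG)^2 B x| <= |B x|]. *)
Lemma cdual_Acontraction : Acontraction ip (Dsq ip (opow T' 2)) T'.
Proof.
have [bP PP sP] := isP; have bT' := bop_cdual; have [EP PE] := Dsq_cdual_absorb.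
have b2 := bop_opow hH 2 bT'.
have hS := bop_comp hH bop_compressT bop_gram_inv.
have bE : bop ip E := bop_Dsq hH bT'.
have pE : ople ip (@zeroop R H) E := Dsq_positive hH bT' cdual_nrm.
have [bB pB BB cB] := opsqrt_spec hH bE pE; set B := opsqrt ip E in bB pB BB cB.
have sB := positive_symmetric hH bB pB.
have SGn y : nrm ip ((S \o G) y) <= nrm ip y.
  rewrite -compress_cdual; apply: le_trans (proj_nrm hH _ isP) _.
  apply: le_trans (cdual_nrm _) _; exact: proj_nrm.
have Bform y : rip ip (E y) y = rip ip (B y) (B y) by rewrite -BB /rip sB.
have Eform y : rip ip (E y) y = rip ip y y - rip ip (T' y) (T' y).
  by rewrite /rip (Dsq_form hH).
have main y : rip ip (E (T' (T' y))) (T' (T' y)) <= rip ip (E y) y.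
  have -> : rip ip (E (T' (T' y))) (T' (T' y)) =
      rip ip (E ((S \o G) ((S \o G) y))) ((S \o G) ((S \o G) y)).
    have PT z : P (T' z) = (S \o G) z.
      by rewrite -compress_cdual /= (ker_block _ isP) //; exact: cdual_inv.
    have SGP z : (S \o G) (P z) = (S \o G) z by rewrite -compress_cdual /= PP.
    by rewrite -{1}EP -PE /rip sP PT -(SGP (T' y)) PT.
  rewrite !Bform -!(cB _ hS compress_cdual_comm_Dsq) -!(nrm_sqr hH) ler_sqr ?nnegrE ?nrm_ge0 //.
  exact: le_trans (SGn _) (SGn _).
move=> x; rewrite (adjE' hH bT') !(Dsq_form hH _ b2) lecR.
have := main x; rewrite !Eform /=; rewrite /idop; lra.
Qed.

Lemma cdual_regular_iff :
  Acontraction ip (Dsq ip (opow T' 2)) T' /\ Aregular ip (Dsq ip (opow T' 2)) T'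
  <-> quasinormal ip (S \o G).
Proof.
have [bP PP sP] := isP; have bT' := bop_cdual; have b2 := bop_opow hH 2 bT'.
have hS := bop_comp hH bop_compressT bop_gram_inv.
have bE : bop ip E := bop_Dsq hH bT'.
(* In [|T'^2 x| <= |T' x| <= |x|], equality of the outer terms forces equality of the last two. *)
have kerA x : Dsq ip (opow T' 2) x = 0 <-> P x = 0.
  split=> [/(Dsq_ker hH x b2 cdual2_nrm) h|h].
    apply/Dsq_cdual_ker/(Dsq_ker hH x bT' cdual_nrm).
    have := cdual_nrm x; have := cdual_nrm (T' x).
    rewrite !nrm_le ?nrm_ge0 // !(nrm_sqr hH); move: h; rewrite /= /idop => <- h1 h2.
    by apply/le_anti; rewrite h1 h2.
  rewrite Dsq_cdual2 (Dsq_cdual_ker x).2 // add0r.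
  have -> : (S \o G) x = 0 by rewrite /= proj_comm_gram_inv h (bop0 bop_gram_inv) (bop0 hT) (bop0 bP).
  by rewrite (bop0 bE) (bop0 (bop_adj hH hS)).
have := Aregular_iff hH (bop_Dsq hH b2) (Dsq_positive hH b2 cdual2_nrm) isP kerA bT'
  cdual_inv.
have sgE x : P (T' (P x)) = (S \o G) x by rewrite -compress_cdual.
move=> regE; rewrite regE.
have PS x : P ((S \o G) x) = (S \o G) x by exact: PP.
have PS' x : P (adj ip (S \o G) x) = adj ip (S \o G) x.
  by rewrite -compress_cdual (adj_compression hH isP bT') /= PP.
rewrite -(commute_sum_iff hH isP hS bE (symmetric_Dsq hH bT') Dsq_cdual_ker PS PS'
  compress_cdual_comm_Dsq Dsq_cdual2).
split=> [[_ h] x|h]; first by rewrite -sgE h sgE.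
by split; [exact: cdual_Acontraction | move=> x; rewrite !sgE].
Qed.

End RegularConcave.

Theorem theorem4p1 (R : realType) (H : lmodType R[i]) (ip : H -> H -> R[i])
  (hH : is_hilbert ip) (T : H -> H) (hT : bop ip T) (hconc : concave ip T) :
  (forall m n : nat, (1 <= m)%N -> (1 <= n)%N ->
     Acontraction ip (Delta ip (opow T m)) (opow T n)) /\
  (forall n : nat, (1 <= n)%N ->
     kerop (Delta ip T) = kerop (Delta ip (opow T n))) /\
  (Aregular ip (Delta ip T) T ->
   let Rg := hclosure ip (ranop (Delta ip T)) in
   let Nk := kerop (Delta ip T) in
   let That := compress ip Rg Rg T in
   let Zhat := compress ip Nk Rg T in
   let T' := cdual ip T in
   let T'0 := compress ip Rg Rg T' in
   let T'1 := compress ip Nk Rg T' in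
   [<-> (forall m n : nat, (1 <= m)%N -> (1 <= n)%N ->
           Aregular ip (Delta ip (opow T m)) (opow T n));
        quasinormal ip That;
        commute_op That (adj ip Zhat \o Zhat);
        Acontraction ip (Dsq ip (opow T' 2)) T' /\
          Aregular ip (Dsq ip (opow T' 2)) T';
        quasinormal ip T'0;
        commute_op T'0 (adj ip T'1 \o T'1)]).
Proof.
split; first by move=> m n _ _; exact: concave_Acontraction.
split.
  move=> n n1; apply/funext => x; apply/propext; exact: (concave_ker_opow hH hT hconc).
move=> reg Rg Nk That Zhat T' T'0 T'1.
have [P [isP RgE NkE kerP]] :=
  ran_ker_proj hH (bop_Delta hH hT) (symmetric_Delta hH hT).
have i1 := regular_quasinormal_iff hH hT hconc isP kerP reg.
have i3 := commute_offdiag_iff hH hT hconc isP kerP reg.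
have i4 := cdual_regular_iff hH hT hconc isP kerP reg.
have i5 := quasinormal_cdual_iff hH hT hconc isP kerP reg.
have i6 := commute_offdiag_cdual_iff hH hT hconc isP kerP reg.
have e5 := compress_cdual hH hT hconc isP kerP.
rewrite /T'0 /T'1 /That /Zhat /compress /Rg /Nk RgE NkE /T' e5.
(* Every implication of the cycle passes through quasinormality of [S] or of [S \o G], and [i5]
   exchanges the two. *)
by tfae; [move/i1 | move/i3 | move/i3/i5/i4 | move/i4 | move/i6 | move/i6/i5/i1].
Qed.
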